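(* Let $\lambda^{(1)}, \lambda^{(2)}, \ldots$ be a sequence of partitions, and for each $N$ let $X_N$ be the random variable $\mathrm{maj}(T)$, where $T$ is chosen uniformly at random from the set $\mathrm{SYT}(\lambda^{(N)})$ of standard Young tableaux of shape $\lambda^{(N)}$. Then the sequence $X_1, X_2, \ldots$ is asymptotically normal if and only if $\mathrm{aft}(\lambda^{(N)}) \to \infty$ as $N \to \infty$.
   Context: For a partition $\lambda=(\lambda_1\ge\lambda_2\ge\cdots)$ of $n=|\lambda|$, $\lambda'$ denotes the conjugate (transpose) partition, and $\mathrm{aft}(\lambda) := |\lambda| - \max\{\lambda_1, \lambda_1'\}$. Diagrams are drawn in English notation (row 1 at the top). A standard Young tableau of shape $\lambda$ is a bijective filling of the cells of $\lambda$ with $1,\ldots,n$ increasing to the right along rows and downward along columns. An integer $i\in\{1,\dots,n-1\}$ is a descent of $T$ if $i+1$ lies in a strictly lower row of $T$ than $i$; the major index $\mathrm{maj}(T)$ is the sum of the descents of $T$. For a real random variable $X$ with mean $\mu$ and variance $\sigma^2>0$, the normalized variable is $X^* := (X-\mu)/\sigma$; if $\sigma=0$, by convention $X^*:=0$. A sequence $X_1,X_2,\ldots$ is asymptotically normal if $X_N^*$ converges in distribution to the standard normal random variable, i.e. $\lim_{N\to\infty}\mathbb{P}[X_N^*\le t]=\mathbb{P}[\mathcal{N}(0,1)\le t]$ for all $t\in\mathbb{R}$. *)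

(* Defs.v *)
From HB Require Import structures.
From mathcomp Require Import all_boot all_order all_algebra finmap.
From mathcomp Require Import all_classical all_reals all_analysis.

Set Implicit Arguments.
Unset Strict Implicit.
Unset Printing Implicit Defensive.

Import Order.TTheory GRing.Theory Num.Theory.
Import numFieldNormedType.Exports.

Record intpart := Intpart {
  parts :> seq nat;
  parts_sorted : sorted geq parts;
  parts_pos : 0 \notin parts
}.

Definition conj_parts (la : seq nat) : seq nat :=
  [seq count (leq j) la | j <- iota 1 (head 0 la)].

Definition aft (la : intpart) : nat :=
  sumn la - maxn (head 0 la) (head 0 (conj_parts la)).

(* The cell in row [i] and column [j], both counted from 0. *)
Definition cell (la : intpart) : finType := {i : 'I_(size la) & 'I_(nth 0 la i)}.

Definition row_of (la : intpart) (c : cell la) : nat := tag c.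
Definition col_of (la : intpart) (c : cell la) : nat := tagged c.

Definition filling (la : intpart) : finType := {ffun cell la -> 'I_(sumn la)}.

(* ['I_n] is {0, ..., n-1}, whereas the entries of a tableau are 1, ..., n. *)
Definition entry (la : intpart) (T : filling la) (c : cell la) : nat := (T c).+1.

Definition standard (la : intpart) (T : filling la) : bool :=
  [&& injectiveb T,
      [forall k, exists c, T c == k],
      [forall c, forall d, (row_of c == row_of d) && (col_of c < col_of d)
                           ==> (entry T c < entry T d)] &
      [forall c, forall d, (col_of c == col_of d) && (row_of c < row_of d)
                           ==> (entry T c < entry T d)]].

Record SYT (la : intpart) := MkSYT {
  syt_filling :> filling la;
  syt_standard : standard syt_filling
}.

HB.instance Definition _ la := [isSub for @syt_filling la].
HB.instance Definition _ la := [Finite of SYT la by <:].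

Definition descent (la : intpart) (T : SYT la) (i : nat) : bool :=
  [exists c, exists d, [&& entry T c == i, entry T d == i.+1 & row_of c < row_of d]].

Definition maj (la : intpart) (T : SYT la) : nat :=
  \sum_(1 <= i < sumn la | descent T i) i.

Section row_tableau.
Variable la : intpart.

Let rank (c : cell la) : nat := sumn (take (row_of c) la) + col_of c.

Let sumn_take_le (s : seq nat) i k :
  i < k -> sumn (take i s) + nth 0 s i <= sumn (take k s).
Proof.
elim: s i k => [|x s IHs] [|i] [|k] //=; rewrite ?ltnS.
  by move=> _; rewrite add0n leq_addr.
by move=> ik; rewrite -addnA leq_add2l IHs.
Qed.

Let rank_row c d : row_of c < row_of d -> rank c < rank d.
Proof.
move=> cd; rewrite /rank; apply: leq_trans (leq_addr _ _).
apply: leq_trans (sumn_take_le la cd); rewrite ltn_add2l.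
exact: ltn_ord (tagged c).
Qed.

Let rank_col c d :
  row_of c = row_of d -> col_of c < col_of d -> rank c < rank d.
Proof. by rewrite /rank => ->; rewrite ltn_add2l. Qed.

Let rank_bound c : rank c < sumn la.
Proof.
rewrite -[X in _ < sumn X](take_size la).
apply: leq_trans (sumn_take_le la (ltn_ord (tag c))).
by rewrite ltn_add2l; exact: ltn_ord (tagged c).
Qed.

Let fill : filling la := [ffun c => Ordinal (rank_bound c)].

Let fill_inj : injective fill.
Proof.
move=> c d; rewrite !ffunE => /(congr1 val)/= E.
have [|/rank_row|rcd] := ltngtP (row_of c) (row_of d).
- by move/rank_row; rewrite E ltnn.
- by rewrite E ltnn.
have [/(rank_col rcd)|/(rank_col (esym rcd))|ccd] := ltngtP (col_of c) (col_of d).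
- by rewrite E ltnn.
- by rewrite E ltnn.
case: c d rcd ccd {E} => [i j] [k l]; rewrite /row_of /col_of /=.
by move=> /val_inj ik; subst k => /val_inj ->.
Qed.

Let card_cell : #|{: cell la}| = sumn la.
Proof.
rewrite card_tagged.
under eq_map do rewrite card_ord.
rewrite -[LHS]/(sumn [seq nth 0 la (nat_of_ord i) | i <- enum 'I_(size la)]).
rewrite (map_comp (nth 0 la) (@nat_of_ord _)) val_enum_ord.
by rewrite -/(mkseq _ _) mkseq_nth.
Qed.

Let fill_standard : standard fill.
Proof.
apply/and4P; split.
- exact/injectiveP.
- have /inj_card_onto on := fill_inj.
  apply/forallP => k; apply/existsP.
  have /codomP[c ->] : k \in codom fill by apply: on; rewrite card_cell card_ord.
  by exists c.
- apply/forallP => c; apply/forallP => d; apply/implyP => /andP[/eqP rcd ccd].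
  by rewrite /entry !ffunE ltnS /=; exact: rank_col.
- apply/forallP => c; apply/forallP => d; apply/implyP => /andP[_ rcd].
  by rewrite /entry !ffunE ltnS /=; exact: rank_row.
Qed.

(* The cells are filled row after row; this shows that [SYT la] is nonempty. *)
Definition row_tableau : SYT la := MkSYT fill_standard.

End row_tableau.

HB.instance Definition _ la := isPointed.Build (SYT la) (row_tableau la).

Local Open Scope classical_set_scope.
Local Open Scope ring_scope.

HB.instance Definition _ la := @isMeasurable.Build default_measure_display
  (SYT la) discrete_measurable discrete_measurable0
  discrete_measurableC discrete_measurableU.

Section uniform_SYT.
Variables (R : realType) (la : intpart).

Definition uniform_SYT : set (SYT la) -> \bar R :=
  mscale (#|{: SYT la}|%:R^-1)%:nng counting.

HB.instance Definition _ := Measure.on uniform_SYT.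

Let uniform_SYT_setT : uniform_SYT [set: SYT la] = 1%E.
Proof.
have -> : [set: SYT la] = [set` seq_fset tt (enum {: SYT la})].
  apply/esym/seteqP; split => // T _; apply: (etrans (seq_fsetE _ _ _)).
  by rewrite mem_enum.
rewrite /uniform_SYT /mscale -[X in (_ * X)%E]/(counting _) /counting asboolT; last exact: finite_fset.
rewrite set_fsetK size_seq_fset undup_id ?enum_uniq// -cardE -EFinM mulVf//.
by rewrite pnatr_eq0 -lt0n; apply/card_gt0P; exists (row_tableau la).
Qed.

HB.instance Definition _ :=
  Measure_isProbability.Build _ _ R uniform_SYT uniform_SYT_setT.

Definition majR (T : SYT la) : R := (maj T)%:R.

Let measurable_majR : measurable_fun [set: SYT la] majR.
Proof. by []. Qed.

HB.instance Definition _ :=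
  isMeasurableFun.Build _ _ (SYT la) R majR measurable_majR.

End uniform_SYT.

Arguments uniform_SYT : clear implicits.
Arguments majR R {la} T.

Definition maj_RV (R : realType) (la : intpart) :
  {RV (uniform_SYT R la) >-> R} := majR R.

(* Meant for [X] with finite variance, so that [fine] loses nothing. *)
Definition standardize d (T : measurableType d) (R : realType)
    (P : probability T R) (X : {RV P >-> R}) : T -> R :=
  let mu := fine 'E_P[X] in
  let sigma := Num.sqrt (fine 'V_P[X]) in
  fun x => if sigma == 0 then 0 else (X x - mu) / sigma.

Definition asymptotically_normal (R : realType) (d : nat -> measure_display)
    (T : forall n, measurableType (d n)) (P : forall n, probability (T n) R)
    (X : forall n, {RV (P n) >-> R}) : Prop :=
  forall t : R,
    P n [set x | standardize (X n) x <= t] @[n --> \oo]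
      --> normal_prob 0 1 `]-oo, t].

(* Main.v *)
(* The random variable maj is studied through its characteristic function.

   Adding the largest entry of a tableau in row [i] gives a recursion for the generating function of maj, refined by the comparison of the row of the largest entry with a given row.  The same recursion holds for a determinant whose rows are switched one by one from [q ^ (j m) / (q; q)_m] to the difference of two such rows, because a determinant with two equal rows vanishes.  This yields Stanley's formula: the generating function is a power of [q] times the product of [1 - q ^ a] for [1 <= a <= n], divided by the product of [1 - q ^ h] over the hook lengths [h].

   At [q = exp (i t)] this is a quotient of products of [sin (a t / 2)] and [sin (h t / 2)].  At most [n + 1 - m] hook lengths are at least [m], so sums over [1, ..., n] minus sums over the hook lengths can be estimated from increments; with [S = sum a ^ 2 - sum h ^ 2] and [t <= 2 / n], the logarithm of the characteristic function of the centered variable is [- t ^ 2 S / 24] up to [t ^ 4 n ^ 2 S / 16].  Hence the variance is [S / 12], and asymptotic normality follows as soon as [n ^ 2 / S] tends to 0.  Since the sum of the squared hook lengths is [n ^ 2] plus the sum of the squared contents, [S >= aft * n ^ 2 / 48].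

   Conversely, maj takes its values in an interval of length [aft * n], so the normalized variable is bounded in terms of aft, and a subsequence with bounded aft cannot converge to a normal variable. *)

Require Import Defs.
From HB Require Import structures.
From mathcomp Require Import all_boot all_order all_algebra.
From mathcomp Require Import all_classical all_reals all_analysis.
From mathcomp Require Import measurable_realfun ring lra zify complex.

Set Implicit Arguments.
Unset Strict Implicit.
Unset Printing Implicit Defensive.

Import Order.TTheory GRing.Theory Num.Theory.
Import numFieldNormedType.Exports.

(** * A determinantal formula for the generating function of maj *)

(** The major index alone has no closed recursion: appending a letter [i] changes it only if the
    previous letter is smaller than [i], and the argument [r] records this comparison. The number of
    tableaux, the mean and the variance are not computed beforehand. All three are read off as [t]
    tends to 0 from one identity for the sum of [cos (t (maj - maj_center))]. That identity is
    available only for [t n <= 2]. This is enough, because the normalized variable uses it at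
    [t = |a| / sigma], and [n / sigma] tends to 0 when [aft] tends to infinity. The passage from
    cosines to distribution functions approximates the indicator of a half-line, on a large
    interval, by a trigonometric polynomial with values in [0, 1]; uniform tail bounds control the
    rest of the line. *)

Section determinantal_formula.
Local Open Scope ring_scope.
Variables (F : fieldType) (q : F).
Implicit Types (l : nat -> nat) (n m r : nat).

Definition rm_cell l i : nat -> nat := fun j => (l j - (j == i))%N.

(* The sum of [q ^ (maj w + n [w_n < r])] over the lattice words [w] of length [n] whose letters [i < k] have multiplicities [l i]. *)
Fixpoint word_maj_gf k n l r : F :=
  if n is n'.+1 then
    \sum_(i < k | (l i.+1 < l i)%N)
      q ^+ (n * (i < r)%N) * word_maj_gf k n' (rm_cell l i) i
  else 1.

Definition qpoch m : F := \prod_(a < m) (1 - q ^+ a.+1).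

Lemma qpochS m : qpoch m.+1 = qpoch m * (1 - q ^+ m.+1).
Proof. by rewrite /qpoch big_ord_recr. Qed.

Variable k : nat.

Definition beta l (i : nat) : nat := (l i + (k - i.+1))%N.

(* The argument of [qentry] is shifted by one, so that [0] stands for the beta number [-1]. *)
Definition qentry m j : F :=
  if m is m'.+1 then q ^+ (m' * j) / qpoch m' else 0.

Definition qmx r l : 'M[F]_k :=
  \matrix_(i, j) if (i < r)%N then qentry (beta l i).+1 j - qentry (beta l i) j
                 else qentry (beta l i).+1 j.

Definition is_part l := (forall i, l i.+1 <= l i)%N /\ l k = 0%N.

Lemma rm_cell_part l i : is_part l -> (i < k)%N -> (l i.+1 < l i)%N ->
  is_part (rm_cell l i).
Proof.
move=> [ld lk] ik li; split=> [j|]; rewrite /rm_cell; last by rewrite lk sub0n.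
have := ld j; case: (eqVneq j.+1 i) => [<-|_]; case: (eqVneq j i) => [->|_] //=; lia.
Qed.

(** The two matrices differ only in row [r], so by multilinearity the difference is the determinant
    whose row [r] has its beta number lowered by one, as if a cell were removed. If that cell cannot
    be removed, the new row equals row [r.+1], or is zero when [r] is the last row. *)
Lemma det_qmx_diff (r : 'I_k) l : is_part l ->
  \det (qmx r l) - \det (qmx r.+1 l) =
  if (l r.+1 < l r)%N then \det (qmx r (rm_cell l r)) else 0.
Proof.
move=> [ld lk].
pose C := \matrix_(i, j) if i == r then qentry (beta l r) j else qmx r l i j.
have -> : \det (qmx r l) = 1 * \det (qmx r.+1 l) + 1 * \det C.
  apply: (determinant_multilinear (i0 := r)).
  - by apply/rowP => j; rewrite !mxE eqxx ltnn ltnSn !mul1r subrK.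
  - apply/matrixP => i j; rewrite !mxE ltnS leq_eqVlt.
    by rewrite (_ : (nat_of_ord _ == r) = false) //; apply/negbTE; rewrite eq_sym neq_lift.
  - apply/matrixP => i j; rewrite !mxE.
    by rewrite (_ : (_ == r) = false) //; apply/negbTE; rewrite eq_sym neq_lift.
rewrite !mul1r addrAC subrr add0r.
case: ifPn => [lr|].
  congr (\det _); apply/matrixP => i j; rewrite !mxE /rm_cell /beta.
  case: (eqVneq i r) => [->|ir]; last first.
    by rewrite (_ : (nat_of_ord i == r) = false) ?subn0 //; apply/negbTE.
  rewrite ltnn eqxx.
  by have -> : (l r + (k - r.+1) = (l r - true + (k - r.+1)).+1)%N by lia.
rewrite -leqNgt => lr; have {}lr : l r.+1 = l r by apply/eqP; rewrite eqn_leq ld.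
have [rk|rk] := ltnP r.+1 k.
  pose r' := Ordinal rk.
  apply: (@determinant_alternate _ _ C r r').
    by apply/eqP => /(congr1 val) /=; lia.
  move=> j; rewrite !mxE eqxx (_ : r' == r = false).
    rewrite /= ltnNge leqnSn /= /beta lr.
    by have -> : (l r + (k - r.+1) = (l r + (k - r.+2)).+1)%N by lia.
  by apply/negbTE/eqP => /(congr1 val) /=; lia.
have rk' : r.+1 = k by have := ltn_ord r; lia.
rewrite (expand_det_row _ r) big1 // => j _; rewrite !mxE eqxx.
by rewrite /beta -lr rk' lk subnn /= mul0r.
Qed.

Hypothesis q0 : q != 0.
Variable B : nat.
Hypothesis qB : forall a, (0 < a <= B)%N -> 1 - q ^+ a != 0.

Lemma qpoch_neq0 m : (m <= B)%N -> qpoch m != 0.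
Proof.
move=> mB; apply/prodf_neq0 => i _; apply: qB => /=.
exact: leq_trans (ltn_ord i) mB.
Qed.

(** The entries come from [q^((m-1)j) (q^j - 1 + q^m) = q^m (q^(mj) q^(-j) + q^(m(j-1)) (1 -
    q^(-j)))]. They do not depend on [m], so one matrix serves all rows. *)
Definition qtrans : 'M[F]_k := \matrix_(i, j)
  if i == j then q ^- j else if i.+1 == j :> nat then 1 - q ^- j else 0.

Lemma qentry_diff m (j : 'I_k) : (m <= B)%N ->
  qentry m.+1 j - qentry m j =
  q ^+ m * \sum_(i < k) qentry m.+1 i * qtrans i j.
Proof.
move=> mB; have qj i : q ^+ i != 0 by rewrite expf_neq0.
have Pn0 := qpoch_neq0 mB.
have -> : \sum_(i < k) qentry m.+1 i * qtrans i j =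
   qentry m.+1 j * q ^- j +
   (if j == 0%N :> nat then 0 else qentry m.+1 j.-1 * (1 - q ^- j)).
  rewrite (bigD1 j) //= mxE eqxx; congr (_ + _).
  case: ifPn => [/eqP j0|j0].
    apply: big1 => i /negbTE ij; rewrite mxE ij.
    by rewrite (_ : (i.+1 == j) = false) ?mulr0 // j0.
  have jk : (j.-1 < k)%N by have := ltn_ord j; lia.
  rewrite (bigD1 (Ordinal jk)) /=; last first.
    by apply/eqP => /(congr1 val) /=; lia.
  rewrite big1 ?addr0.
    rewrite mxE ifN /=; last by apply/eqP => /(congr1 val) /=; lia.
    by rewrite prednK ?lt0n // eqxx.
  move=> i /andP[/negbTE ij ij']; rewrite mxE ij ifN ?mulr0 //.
  apply: contra ij' => /eqP ij'; apply/eqP/val_inj => /=; lia.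
case: m mB Pn0 => [|m] mB Pn0.
  rewrite /= /qpoch big_ord0 divr1 subr0 !mul0n expr0 !mul1r.
  by case: ifPn => [/eqP ->|_]; [rewrite expr0 addr0 invr1 | field].
have Pm0 : qpoch m != 0 by apply: qpoch_neq0; lia.
move: Pn0; rewrite qpochS mulf_eq0 negb_or => /andP[_ qm0].
rewrite /= qpochS; case: (posnP j) => [->|j0].
  rewrite !muln0 !expr0 addr0; by field; rewrite Pm0 qm0 oner_neq0.
have -> : q ^+ (m.+1 * j) = q ^+ (m * j) * q ^+ j.
  by rewrite mulSn exprD mulrC.
have -> : q ^+ (m.+1 * j.-1) = q ^+ (m * j) * q ^+ j / q ^+ m.+1.
  apply: (@mulIf _ (q ^+ m.+1)) => //; rewrite divfK // -!exprD; congr (_ ^+ _); nia.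
by field; rewrite Pm0 qm0 !qj.
Qed.

Lemma det_qtrans : \det qtrans = (\prod_(j < k) q ^+ j)^-1.
Proof.
rewrite -det_tr det_trig.
  by rewrite -prodfV; apply: eq_bigr => i _; rewrite !mxE eqxx.
apply/is_trig_mxP => i j ij; rewrite !mxE.
rewrite ifN; last by apply: contraL ij => /eqP ->; rewrite ltnn.
by rewrite ifN // neq_ltn; apply/orP; right; lia.
Qed.

(** The scalars of [qentry_diff] contribute [q] to the sum of the beta numbers, and [qtrans] removes
    the staircase part of that sum. *)
Lemma det_qmx_shift l : is_part l -> (forall i : 'I_k, beta l i <= B)%N ->
  \det (qmx k l) = q ^+ (\sum_(i < k) l i)%N * \det (qmx 0 l).
Proof.
move=> lp lB.
have -> : qmx k l = diag_mx (\row_i q ^+ beta l i) *m (qmx 0 l *m qtrans).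
  apply/matrixP => i j; rewrite mul_diag_mx !mxE ltn_ord qentry_diff //.
  by congr (_ * _); apply: eq_bigr => m _; rewrite !mxE.
rewrite !det_mulmx det_diag det_qtrans mulrCA mulrC; congr (_ * _).
under eq_bigr do rewrite mxE /beta exprD.
rewrite big_split /= prodrXr.
have -> : \prod_(i < k) q ^+ (k - i.+1) = \prod_(j < k) q ^+ j.
  by rewrite [RHS](reindex_inj rev_ord_inj).
rewrite mulfK //; apply/prodf_neq0 => i _; exact: expf_neq0.
Qed.

(** Induction on [n]. With [D i = \det (qmx i l)], the recursion telescopes to
    [q^n (D 0 - D r) + (D r - D k)]; since [D k = q^n D 0], only [(1 - q^n) D r] is left, which is
    the new factor of [qpoch n]. *)
Lemma word_maj_gf_det n l r : is_part l -> (\sum_(i < k) l i)%N = n ->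
  (forall i : 'I_k, beta l i <= B)%N -> (n <= B)%N -> (r <= k)%N ->
  word_maj_gf k n l r * \det (qmx 0 (fun=> 0%N)) = qpoch n * \det (qmx r l).
Proof.
elim: n l r => [|n IH] l r lp ln lB nB rk.
  rewrite /= /qpoch big_ord0 !mul1r.
  have l0 i : l i = 0%N.
    have [ik|] := ltnP i k; first by move: ln; rewrite (bigD1 (Ordinal ik)) //=; lia.
    case: lp => ld lk; elim: i => [|i IHi].
      by rewrite leqn0 => /eqP k0; move: lk; rewrite k0.
    rewrite leq_eqVlt => /predU1P[<- //|]; rewrite ltnS => /IHi li.
    by have := ld i; rewrite li leqn0 => /eqP.
  have -> : l = fun=> 0%N by apply/funext.
  (* No cell can be removed from the empty partition, so by [det_qmx_diff] the determinant does not
     depend on [r]. *)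
  elim: r rk => [//|r IHr] rk.
  rewrite (IHr (ltnW rk)); apply/eqP; rewrite -subr_eq0.
  have := @det_qmx_diff (Ordinal rk) (fun=> 0%N) (conj (fun=> leqnn _) erefl).
  by rewrite /= => ->.
rewrite [word_maj_gf _ _ _ _]/= mulr_suml.
have step (i : 'I_k) : (l i.+1 < l i)%N ->
    q ^+ (n.+1 * (i < r)%N) * word_maj_gf k n (rm_cell l i) i * \det (qmx 0 (fun=> 0%N)) =
    q ^+ (n.+1 * (i < r)%N) * (qpoch n * (\det (qmx i l) - \det (qmx i.+1 l))).
  move=> li; rewrite -mulrA IH ?det_qmx_diff ?li //.
  - exact: rm_cell_part.
  - move: ln; rewrite (bigD1 i) //= [in X in _ -> X](bigD1 i) //= /rm_cell eqxx => ln.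
    suff -> : (\sum_(j < k | j != i) (l j - (nat_of_ord j == i)) = \sum_(j < k | j != i) l j)%N.
      by move: ln; set S := (\sum_(_ < _ | _) _)%N => ln; rewrite subn1; lia.
    by apply: eq_bigr => j /negbTE ji; rewrite (_ : (nat_of_ord j == i) = (j == i)) // ji subn0.
  - by move=> j; apply: leq_trans (lB j); rewrite /beta /rm_cell; lia.
  - exact: ltnW.
  - exact: ltnW.
rewrite (eq_bigr _ step) big_mkcond /=.
have {step} -> : \sum_(i < k) (if (l i.+1 < l i)%N then
    q ^+ (n.+1 * (i < r)%N) * (qpoch n * (\det (qmx i l) - \det (qmx i.+1 l))) else 0) =
  qpoch n * \sum_(0 <= i < k) q ^+ (n.+1 * (i < r)%N) * (\det (qmx i l) - \det (qmx i.+1 l)).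
  rewrite big_mkord mulr_sumr; apply: eq_bigr => i _.
  case: ifPn => [_|li]; first by ring.
  by rewrite det_qmx_diff // (negbTE li) !mulr0.
rewrite qpochS -mulrA; congr (_ * _).
rewrite (@big_cat_nat _ _ _ r) //=.
rewrite (@eq_big_nat _ _ _ 0 r _ (fun i => q ^+ n.+1 * - (\det (qmx i.+1 l) - \det (qmx i l)))); last first.
  by move=> i /andP[_ ir]; rewrite ir muln1 opprB.
rewrite (@eq_big_nat _ _ _ r k _ (fun i => - (\det (qmx i.+1 l) - \det (qmx i l)))); last first.
  by move=> i /andP[ri _]; rewrite ltnNge ri muln0 expr0 mul1r opprB.
rewrite -mulr_sumr !sumrN !telescope_sumr // det_qmx_shift // ln.
by ring.
Qed.

End determinantal_formula.

(** * Hook lengths *)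

Section hooks.
Variables (k B : nat) (l : nat -> nat).
Hypothesis lp : is_part k l.
Hypothesis lB : forall i : 'I_k, beta k l i <= B.

Let bt (i : 'I_k) : 'I_B.+1 := inord (beta k l i).

Let btE i : bt i = beta k l i :> nat.
Proof. by rewrite inordK // ltnS. Qed.

Lemma beta_lt (i j : 'I_k) : (beta k l j < beta k l i) = (i < j).
Proof.
have lmono a b : a <= b -> l b <= l a.
  by elim: b => [|b IH]; [case: a | rewrite leq_eqVlt => /predU1P[->//|/IH]; have := lp.1 b; lia].
have := ltn_ord i; have := ltn_ord j; rewrite /beta.
have [ij|ji] := ltnP i j; first by have := lmono _ _ (ltnW ij); lia.
by have := lmono _ _ ji; lia.
Qed.

Let bt_inj : injective bt.
Proof.
move=> i j /(congr1 val); rewrite /= !btE => ij; apply/val_inj => /=.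
by have := beta_lt i j; have := beta_lt j i; rewrite ij ltnn; case: ltngtP.
Qed.

Definition beta_set : {set 'I_B.+1} := [set bt i | i : 'I_k].

(* In terms of beta numbers, the hooks of a partition are the pairs [x > y] with [x] in the beta set and [y] outside of it, and [x - y] is the hook length. *)
Definition is_hook (p : 'I_B.+1 * 'I_B.+1) :=
  [&& p.1 \in beta_set, p.2 \notin beta_set & p.2 < p.1].

Definition hook_len (p : 'I_B.+1 * 'I_B.+1) := p.1 - p.2.

(** A number below [beta k l i] either lies outside of the beta set, and gives a hook, or is
    [beta k l j] for some [j > i]. The monoid is arbitrary because the lemma serves for counting
    hooks, for products of [1 - q ^ a] and for sums of squares. *)
Lemma big_hook (T : Type) (idx : T) (op : Monoid.com_law idx) (f : nat -> T) :
  op (\big[op/idx]_(p | is_hook p) f (hook_len p))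
     (\big[op/idx]_(i < k) \big[op/idx]_(j < k | i < j) f (beta k l i - beta k l j)) =
  \big[op/idx]_(i < k) \big[op/idx]_(a < beta k l i) f a.+1.
Proof.
have -> : \big[op/idx]_(p | is_hook p) f (hook_len p) =
    \big[op/idx]_(i < k) \big[op/idx]_(y < B.+1 | (y \notin beta_set) && (y < beta k l i)) f (beta k l i - y).
  rewrite -(pair_big_dep (mem beta_set) (fun x y => (y \notin beta_set) && (y < x))
    (fun x y : 'I_B.+1 => f (x - y))) /=.
  rewrite big_imset /=; last by move=> i j _ _ /bt_inj.
  by apply: eq_bigr => i _; rewrite btE.
rewrite -big_split /=; apply: eq_bigr => i _.
have -> : \big[op/idx]_(j < k | i < j) f (beta k l i - beta k l j) =
   \big[op/idx]_(y < B.+1 | (y \in beta_set) && (y < beta k l i)) f (beta k l i - y).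
  rewrite [RHS]big_mkcondr /= big_imset /=; last by move=> a b _ _ /bt_inj.
  by rewrite big_mkcond /=; apply: eq_bigr => j _; rewrite btE beta_lt.
have -> : \big[op/idx]_(a < beta k l i) f a.+1 = \big[op/idx]_(0 <= a < beta k l i) f (beta k l i - a).
  rewrite big_mkord (reindex_inj rev_ord_inj) /=.
  by apply: eq_bigr => a _; congr f; have := ltn_ord a; lia.
rewrite (big_nat_widen _ _ B.+1) ?leqW // big_mkord.
rewrite [RHS](bigID (mem beta_set)) /= Monoid.mulmC; congr (op _ _).
  by apply: eq_bigl => y; rewrite andbC.
by apply: eq_bigl => y; rewrite andbC.
Qed.

Lemma card_hook : #|is_hook| = \sum_(i < k) l i.
Proof.
have E (i : 'I_k) : \sum_(j < k | i < j) 1 = k - i.+1.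
  rewrite -(big_mkord (fun j => i < j) (fun=> 1)).
  rewrite (@big_cat_nat _ _ _ i.+1) //=.
  rewrite big_nat_cond big_pred0 => [|j]; last by lia.
  rewrite add0n big_nat_cond (eq_bigl (fun j => (i.+1 <= j < k) && true)) => [|j]; last by lia.
  by rewrite -big_nat_cond sum_nat_const_nat muln1.
have := @big_hook _ _ addn (fun=> 1).
rewrite sum1_card (eq_bigr _ (fun i _ => E i)) => H.
apply: (@addIn (\sum_(i < k) (k - i.+1))); rewrite [LHS]H -big_split /=.
by apply: eq_bigr => i _; rewrite sum1_card card_ord.
Qed.

(* For a hook [(x, y)] of least length at least [m], every [z] strictly between [y] and [x] gives a shorter hook, [(z, y)] or [(x, z)], hence one of length less than [m]. *)
Lemma card_long_hook m : 0 < m -> m <= (\sum_(i < k) l i).+1 ->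
  #|[pred p | is_hook p && (m <= hook_len p)]| <= (\sum_(i < k) l i).+1 - m.
Proof.
move=> m0 mn; have [|] := posnP #|[pred p | is_hook p && (m <= hook_len p)]|.
  by move=> ->.
case/card_gt0P => p0 p0P.
case: (arg_minnP hook_len p0P) => -[x y] /andP[/= xyh mxy] xymin.
have [/= xX yX yx] := and3P xyh.
pose f (a : 'I_(m.-1)) : 'I_B.+1 * 'I_B.+1 :=
  let z : 'I_B.+1 := inord (y + a.+1) in if z \in beta_set then (z, y) else (x, z).
have zE (a : 'I_(m.-1)) : (inord (y + a.+1) : 'I_B.+1) = y + a.+1 :> nat.
  rewrite /= inordK //; apply: leq_ltn_trans (ltn_ord x).
  by move: mxy (ltn_ord a); rewrite /hook_len /=; lia.
have bnd (a : 'I_(m.-1)) : y + a.+1 < x.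
  by move: mxy (ltn_ord a); rewrite /hook_len /=; lia.
have f_hook a : is_hook (f a) && (hook_len (f a) < m).
  have fh : is_hook (f a).
    rewrite /f; case: ifPn => zX; rewrite /is_hook /= ?zX ?xX ?yX /= zE ?bnd //.
    by rewrite -addSnnS leq_addr.
  rewrite fh /= ltnNge; apply/negP => mf.
  have := xymin (f a); rewrite /= fh mf => /(_ isT).
  have := bnd a; rewrite /f /hook_len; case: ifP => _ /=; rewrite zE; lia.
have f_inj : injective f.
  move=> a b; rewrite /f; case: ifPn => aX; case: ifPn => bX.
  - by move=> [] /(congr1 val); rewrite /= !zE => /addnI[] /val_inj.
  - by move=> [] _ yb; move: (congr1 val yb); rewrite /= zE; lia.
  - by move=> [] _ yb; move: (congr1 val yb); rewrite /= zE; lia.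
  - by move=> [] /(congr1 val); rewrite /= !zE => /addnI[] /val_inj.
(* The values of [f] are [m - 1] distinct short hooks; the number of all hooks is known from
   [card_hook]. *)
have : m.-1 <= #|[pred p | is_hook p && (hook_len p < m)]|.
  rewrite -[m.-1]card_ord -(card_codom f_inj); apply: subset_leq_card; apply/fintype.subsetP => p.
  by case/codomP => a ->; exact: f_hook.
have := cardID [pred p | m <= hook_len p] is_hook; rewrite card_hook.
have -> : #|[predI is_hook & [pred p | m <= hook_len p]]| = #|[pred p | is_hook p && (m <= hook_len p)]|.
  by apply: eq_card => p; rewrite !inE.
have -> : #|[predD is_hook & [pred p | m <= hook_len p]]| = #|[pred p | is_hook p && (hook_len p < m)]|.
  by apply: eq_card => p; rewrite !inE -ltnNge andbC.
by move: m0 mn; set a := #|_|; set b := #|_|; set n := \sum_(i < k) l i => *; lia.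
Qed.

End hooks.

(** * Stanley's hook formula for the generating function *)

Section stanley_formula.
Local Open Scope ring_scope.
Variables (F : fieldType) (q : F).
Hypothesis q0 : q != 0.
Variable B : nat.
Hypothesis qB : forall a, (0 < a <= B)%N -> 1 - q ^+ a != 0.

(** The power of [q] that comes out of a Vandermonde product in the [q ^ beta i] when each
    difference is written [q ^ beta j * (1 - q ^ (beta i - beta j))] for [i < j]. *)
Definition vandermonde_exp k l : nat := (\sum_(i < k) \sum_(j < k | i < j) beta k l j)%N.

(** Up to the row factors [1 / qpoch (beta i)], the matrix is a Vandermonde matrix. By [big_hook]
    the product of these [qpoch] is the product over the hooks times the product over the pairs
    [i < j], and the latter cancels. *)
Lemma det_qmx_hook k l : is_part k l -> (forall i : 'I_k, beta k l i <= B)%N ->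
  \det (qmx q k 0 l) * \prod_(p : 'I_B.+1 * 'I_B.+1 | is_hook k l p) (1 - q ^+ hook_len p) =
  q ^+ vandermonde_exp k l.
Proof.
move=> lp lB.
have P0 (i : 'I_k) : qpoch q (beta k l i) != 0 by apply: (qpoch_neq0 qB).
have -> : qmx q k 0 l = diag_mx (\row_i (qpoch q (beta k l i))^-1) *m
    (Vandermonde k (\row_i q ^+ beta k l i))^T.
  by apply/matrixP => i j; rewrite mul_diag_mx !mxE /= mulrC exprM.
rewrite det_mulmx det_diag det_tr det_Vandermonde.
under eq_bigr do rewrite mxE.
rewrite prodfV.
pose P := \prod_(i < k) \prod_(j < k | (i < j)%N) (1 - q ^+ (beta k l i - beta k l j)).
have {1}-> : \prod_(i < k) \prod_(j < k | (i < j)%N)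
   ((\row_i q ^+ beta k l i) 0 j - (\row_i q ^+ beta k l i) 0 i) =
   q ^+ vandermonde_exp k l * P.
  rewrite /vandermonde_exp -prodrXr -big_split /=; apply: eq_bigr => i _.
  rewrite -prodrXr -big_split /=; apply: eq_bigr => j ij.
  rewrite !mxE mulrBr mulr1 -exprD subnKC //.
  by apply: ltnW; rewrite (beta_lt lp).
pose H := \prod_(p : 'I_B.+1 * 'I_B.+1 | is_hook k l p) (1 - q ^+ hook_len p).
have E : H * P = \prod_(i < k) qpoch q (beta k l i).
  exact: (big_hook lp lB *%R (fun a => 1 - q ^+ a)).
rewrite -/H -E [_^-1 * _]mulrCA -mulrA.
suff -> : (H * P)^-1 * P * H = 1 by rewrite mulr1.
rewrite -mulrA [P * H]mulrC mulVf // E.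
by apply/prodf_neq0 => i _.
Qed.

(* Stanley's formula, up to the explicit power of [q]. *)
Lemma word_maj_gf_hook k n l : is_part k l -> (\sum_(i < k) l i)%N = n ->
  (forall i : 'I_k, beta k l i <= B)%N -> (n <= B)%N ->
  q ^+ vandermonde_exp k (fun=> 0%N) * (word_maj_gf q k n l 0 *
    \prod_(p : 'I_B.+1 * 'I_B.+1 | is_hook k l p) (1 - q ^+ hook_len p)) =
  q ^+ vandermonde_exp k l * qpoch q n.
Proof.
move=> lp ln lB nB.
have zp : is_part k (fun=> 0%N) by [].
have zB (i : 'I_k) : (beta k (fun=> 0%N) i <= B)%N.
  by apply: leq_trans (lB i); rewrite /beta add0n leq_addl.
(* The empty partition has no hooks, so the normalizing determinant of [word_maj_gf_det] is a pure
   power of [q]. *)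
have := det_qmx_hook zp zB; rewrite big_pred0; last first.
  have /card0_eq H : #|is_hook k (fun=> 0%N) : pred ('I_B.+1 * 'I_B.+1)| = 0%N by rewrite card_hook // big1.
  by move=> p; exact: H.
rewrite mulr1 => D0.
have := word_maj_gf_det q0 qB lp ln lB nB (leq0n k); rewrite D0 => W.
by rewrite mulrA [q ^+ _ * word_maj_gf _ _ _ _ _]mulrC W -(det_qmx_hook lp lB) -mulrA mulrC.
Qed.

End stanley_formula.

(** * Tableaux as lattice words *)

Lemma is_part_ge k l i : is_part k l -> k <= i -> l i = 0.
Proof.
case=> ld lk; elim: i => [|i IH]; first by rewrite leqn0 => /eqP k0; move: lk; rewrite k0.
rewrite leq_eqVlt => /predU1P[<- //|]; rewrite ltnS => /IH li.
by have := ld i; rewrite li leqn0 => /eqP.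
Qed.

Fixpoint lattice_words k n l : seq (seq nat) :=
  if n is n'.+1 then
    [seq rcons w i | i <- [seq i <- iota 0 k | l i.+1 < l i],
                     w <- lattice_words k n' (rm_cell l i)]
  else [:: [::]].

(** The letters will be row indices, so a descent of the tableau is an ascent of the word. *)
Definition word_maj (w : seq nat) : nat :=
  \sum_(1 <= i < size w | nth 0 w i.-1 < nth 0 w i) i.

Lemma word_maj_rcons w i :
  word_maj (rcons w i) = word_maj w + size w * (last 0 w < i).
Proof.
rewrite /word_maj size_rcons; case: (posnP (size w)) => [/size0nil -> /=|w0].
  by rewrite !big_geq.
rewrite big_mkcond big_nat_recr //= [in RHS]big_mkcond /=; congr (_ + _).
  rewrite !big_nat; apply: eq_bigr => j /andP[j1 jw].
  by rewrite !nth_rcons jw (leq_ltn_trans (leq_pred _) jw).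
rewrite !nth_rcons ltnn eqxx ltn_predL w0 nth_last.
by case: ifP; rewrite ?muln1 ?muln0.
Qed.

(** The second condition is the ballot (Yamanouchi) condition: the letter counts of every prefix are
    weakly decreasing. *)
Definition lattice_word l (w : seq nat) :=
  (forall i, count_mem i w = l i) /\
  (forall m i, count_mem i.+1 (take m w) <= count_mem i (take m w)).


Lemma lattice_wordsP k n l w : is_part k l -> \sum_(i < k) l i = n ->
  w \in lattice_words k n l <-> size w = n /\ lattice_word l w.
Proof.
elim: n l w => [|n IH] l w lp ln.
  rewrite inE; split=> [/eqP -> |[/size0nil -> //]].
  split=> //; split=> // i /=.
  have [ik|ki] := ltnP i k; last by rewrite (is_part_ge lp ki).
  by move: ln; rewrite (bigD1 (Ordinal ik)) //=; lia.
have rmn i : i < k -> l i.+1 < l i -> \sum_(j < k) rm_cell l i j = n.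
  move=> ik li; move: ln; rewrite (bigD1 (Ordinal ik)) //= [in X in _ -> X](bigD1 (Ordinal ik)) //=.
  rewrite /rm_cell eqxx => ln.
  rewrite [X in _ + X](eq_bigr (fun j : 'I_k => l j)); last first.
    move=> j /eqP ji; rewrite (_ : (nat_of_ord j == i) = false) ?subn0 //.
    by apply/eqP => ji'; apply: ji; apply: val_inj.
  by move: ln; set S := \sum_(_ < _ | _) _ => ln; lia.
split=> [/allpairsPdep[i [v [+ vw ->]]]|[]].
  rewrite mem_filter mem_iota /= add0n => /andP[li ik].
  have /(IH _ _ (rm_cell_part lp ik li) (rmn _ ik li))[sv [cv lv]] := vw.
  have cw j : count_mem j (rcons v i) = l j.
    rewrite -cats1 count_cat cv /= /rm_cell addn0 eq_sym; case: eqP => [<-|_]; lia.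
  rewrite size_rcons sv; split=> //; split=> // m j.
  have [mn|nm] := leqP m n; first by rewrite -cats1 takel_cat ?sv.
  by rewrite take_oversize ?size_rcons ?sv // !cw lp.1.
case/lastP: w => [//|w i]; rewrite size_rcons => -[sw] [cw lw].
have ci : count_mem i (rcons w i) = (count_mem i w).+1.
  by rewrite -cats1 count_cat /= eqxx addn0 addn1.
have ik : i < k.
  by rewrite ltnNge; apply/negP => ki; have := cw i; rewrite ci (is_part_ge lp ki).
have lww m j : count_mem j.+1 (take m w) <= count_mem j (take m w).
  have [mn|nm] := leqP m (size w).
    by have := lw m j; rewrite -cats1 takel_cat.
  by have := lw (size w) j; rewrite -cats1 takel_cat // take_oversize // take_oversize // ltnW.
have li : l i.+1 < l i.
  have := lww (size w) i; rewrite take_size -(cw i) ci -cw -cats1 count_cat /=.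
  by rewrite (_ : (i == i.+1) = false) ?addn0 // ltn_eqF.
apply/allpairsPdep; exists i, w; split=> //.
  by rewrite mem_filter li mem_iota.
apply/(IH _ _ (rm_cell_part lp ik li) (rmn _ ik li)); split=> //; split=> // j.
by rewrite /rm_cell -cw -cats1 count_cat /= addn0 eq_sym addnK.
Qed.

Lemma lattice_words_uniq k n l : uniq (lattice_words k n l).
Proof.
elim: n l => [//|n IH] l /=.
apply: allpairs_uniq_dep => [|i _|]; first exact: filter_uniq (iota_uniq _ _).
  exact: IH.
by move=> [i v] [j w] _ _ /= /rcons_inj[-> ->].
Qed.

Lemma size_lattice_words k n l w : w \in lattice_words k n l -> size w = n.
Proof.
elim: n l w => [|n IH] l w; first by rewrite inE => /eqP ->.
by case/allpairsPdep => i [v [_ vw ->]]; rewrite size_rcons (IH _ _ vw).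
Qed.

Lemma word_maj_gfE (F : fieldType) (q : F) k n l r :
  word_maj_gf q k n l r =
  (\sum_(w <- lattice_words k n l) q ^+ (word_maj w + n * (last 0%N w < r)%N))%R.
Proof.
elim: n l r => [|n IH] l r.
  by rewrite /= big_seq1 /word_maj big_geq.
rewrite [lattice_words _ _ _]/= big_allpairs_dep big_filter /=.
rewrite -(big_mkord (fun i => l i.+1 < l i) (fun i =>
  (q ^+ (n.+1 * (i < r)) * word_maj_gf q k n (rm_cell l i) i)%R)).
rewrite /index_iota subn0; apply: eq_bigr => i _.
rewrite IH mulr_sumr !big_seq; apply: eq_bigr => w /size_lattice_words sw.
by rewrite word_maj_rcons last_rcons sw -exprD addnC.
Qed.

Lemma count_takeE (a : pred nat) m (s : seq nat) :
  count a (take m s) = \sum_(p < size s | (p < m) && a (nth 0 s p)) 1.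
Proof.
elim: s m => [|x s IH] [|m]; rewrite ?big_ord0 //; first by rewrite big_pred0.
by rewrite big_mkcond big_ord_recl /= IH -big_mkcond /=; case: (a x).
Qed.

Lemma count_take_lt (w : seq nat) p p' : p < p' -> p < size w ->
  count_mem (nth 0 w p) (take p w) < count_mem (nth 0 w p) (take p' w).
Proof.
move=> pp' pw; apply: (@leq_trans (count_mem (nth 0 w p) (take p.+1 w))).
  by rewrite (take_nth 0) // -cats1 count_cat /= eqxx addn0 addn1.
by rewrite -(cat_take_drop p.+1 (take p' w)) take_takel // count_cat leq_addr.
Qed.

Lemma count_take_le (w : seq nat) i p p' : p <= p' ->
  count_mem i (take p w) <= count_mem i (take p' w).
Proof.
by move=> pp'; rewrite -(cat_take_drop p (take p' w)) take_takel // count_cat leq_addr.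
Qed.

(** Through this coercion [T c] is counted from 0, one less than [entry T c]. *)
Local Definition syt_entry (la : intpart) (T : SYT la) : cell la -> 'I_(sumn la) := syt_filling T.
Local Coercion syt_entry : SYT >-> Funclass.

Section tableau_words.
Variable la : intpart.
Let n := sumn la.
Implicit Types (T : SYT la) (c d : cell la).

Lemma parts_is_part : is_part (size la) (nth 0 la).
Proof.
split=> [i|]; last by rewrite nth_default.
have [il|il] := ltnP i.+1 (size la); last by rewrite nth_default.
by have /(sortedP 0)/(_ i il) := parts_sorted la.
Qed.

Lemma sum_parts : \sum_(i < size la) nth 0 la i = n.
Proof. by rewrite /n sumnE (big_nth 0) big_mkord. Qed.

Lemma cell_eqP c d : row_of c = row_of d -> col_of c = col_of d -> c = d.
Proof.
case: c d => [i j] [i' j']; rewrite /row_of /col_of /=.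
by move=> /val_inj ii; subst i' => /val_inj ->.
Qed.

Lemma ex_cell i j : j < nth 0 la i -> exists c, row_of c = i /\ col_of c = j.
Proof.
move=> ij; have il : i < size la by rewrite ltnNge; apply: contraL ij => /(nth_default 0) ->.
by exists (existT (fun i : 'I_(size la) => 'I_(nth 0 la i)) (Ordinal il) (Ordinal ij)).
Qed.

Lemma col_lt c : col_of c < nth 0 la (row_of c).
Proof. exact: ltn_ord (tagged c). Qed.

Lemma sum_cell (f : nat -> nat -> nat) :
  \sum_(c : cell la) f (row_of c) (col_of c) = \sum_(i < size la) \sum_(j < nth 0 la i) f i j.
Proof. by rewrite sig_big_dep. Qed.

Lemma sum_row_fun r (f : nat -> nat) :
  \sum_(c : cell la | row_of c == r) f (col_of c) = \sum_(j < nth 0 la r) f j.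
Proof.
rewrite big_mkcond (sum_cell (fun i j => if i == r then f j else 0)).
have [rl|rl] := ltnP r (size la); last first.
  rewrite nth_default // big_ord0; apply: big1 => i _; apply: big1 => j _.
  by rewrite ltn_eqF // (leq_trans (ltn_ord i)).
rewrite (bigD1 (Ordinal rl)) //= [X in _ + X]big1 ?addn0 => [|i ir].
  by rewrite eqxx.
apply: big1 => j _; rewrite (_ : (nat_of_ord i == r) = false) //.
by apply: contraNF ir => /eqP i'i; apply/eqP/val_inj.
Qed.

Lemma sum_row r (P : pred nat) :
  \sum_(c : cell la | (row_of c == r) && P (col_of c)) 1 = \sum_(j < nth 0 la r | P j) 1.
Proof.
by rewrite big_mkcondr (sum_row_fun r (fun j => if P j then 1 else 0)) -big_mkcond.
Qed.

Lemma nth_parts_gt0 i : i < size la -> 0 < nth 0 la i.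
Proof.
by move=> il; rewrite lt0n; apply: contraNneq (parts_pos la) => <-; exact: mem_nth.
Qed.

Lemma sum_col0_fun (f : nat -> nat) :
  \sum_(c : cell la | col_of c == 0) f (row_of c) = \sum_(i < size la) f i.
Proof.
rewrite big_mkcond (sum_cell (fun i j => if j == 0 then f i else 0)).
apply: eq_bigr => i _; have := nth_parts_gt0 (ltn_ord i).
by case: (nth 0 la i) => // m _; rewrite big_ord_recl /= big1 ?addn0.
Qed.

Lemma syt_inj T : injective T.
Proof. by have /and4P[/injectiveP] := syt_standard T. Qed.

Lemma syt_onto T (p : 'I_n) : exists c, T c == p.
Proof. by have /and4P[_ /forallP/(_ p)/existsP] := syt_standard T. Qed.

Lemma syt_row T c d : row_of c = row_of d -> col_of c < col_of d -> T c < T d.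
Proof.
have /and4P[_ _ /forallP/(_ c)/forallP/(_ d)/implyP H _] := syt_standard T.
move=> /eqP rcd ccd.
by move: H; rewrite rcd ccd /entry ltnS; apply.
Qed.

Lemma syt_col T c d : col_of c = col_of d -> row_of c < row_of d -> T c < T d.
Proof.
have /and4P[_ _ _ /forallP/(_ c)/forallP/(_ d)/implyP H] := syt_standard T.
move=> /eqP rcd ccd.
by move: H; rewrite rcd ccd /entry ltnS; apply.
Qed.

Lemma syt_row_lt T c d : row_of c = row_of d -> (T c < T d) = (col_of c < col_of d).
Proof.
move=> rcd; case: (ltngtP (col_of c) (col_of d)) => [/(syt_row T rcd) //|ccd|ccd].
  by have := syt_row T (esym rcd) ccd; case: ltngtP.
by rewrite (cell_eqP rcd ccd) ltnn.
Qed.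

Definition cell_at T (p : 'I_n) : cell la := xchoose (syt_onto T p).

Lemma cell_atK T : cancel (cell_at T) T.
Proof. by move=> p; apply/eqP; exact: xchooseP (syt_onto T p). Qed.

Lemma syt_cellK T : cancel T (cell_at T).
Proof. by move=> c; apply: (@syt_inj T); rewrite cell_atK. Qed.

Lemma card_cell : #|{: cell la}| = n.
Proof.
rewrite -[RHS]card_ord; apply: (bij_eq_card (f := (row_tableau la : _ -> _))).
by exists (cell_at (row_tableau la)); [exact: syt_cellK|exact: cell_atK].
Qed.

Definition syt_word T : seq nat := [seq row_of (cell_at T p) | p <- enum 'I_n].

Lemma size_syt_word T : size (syt_word T) = n.
Proof. by rewrite size_map size_enum_ord. Qed.

Lemma nth_syt_word T (p : 'I_n) : nth 0 (syt_word T) p = row_of (cell_at T p).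
Proof. by rewrite (nth_map p) ?size_enum_ord // nth_ord_enum. Qed.

Lemma count_syt_word T i m :
  count_mem i (take m (syt_word T)) = #|[pred c | (T c < m) && (row_of c == i)]|.
Proof.
rewrite count_takeE size_syt_word -sum1_card.
rewrite [RHS](reindex_onto (cell_at T) T) /=; last by move=> c _; rewrite syt_cellK.
by apply: eq_bigl => p; rewrite inE cell_atK eqxx andbT nth_syt_word.
Qed.

(** In the row of [c], the entries smaller than [T c] are exactly those to the left of [c]. Hence
    the word determines the column of each entry as well as its row. *)
Lemma count_syt_word_col T c :
  count_mem (row_of c) (take (T c) (syt_word T)) = col_of c.
Proof.
rewrite count_syt_word -sum1_card (eq_bigl (fun d => (row_of d == row_of c) && (col_of d < col_of c))).
  rewrite (sum_row (row_of c) (fun j => j < col_of c)).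
  rewrite -(big_mkord (fun j => j < col_of c) (fun=> 1)).
  rewrite (@big_cat_nat _ _ _ (col_of c)) //=; last exact: ltnW (col_lt c).
  rewrite [X in _ + X]big_nat_cond [X in _ + X]big_pred0 => [|j]; last by lia.
  rewrite addn0 big_nat_cond (eq_bigl (fun j => (0 <= j < col_of c) && true)) => [|j]; last by lia.
  by rewrite -big_nat_cond sum_nat_const_nat subn0 muln1.
move=> d; rewrite inE andbC; case: eqP => //= rcd.
by rewrite syt_row_lt.
Qed.

Lemma syt_word_inj : injective syt_word.
Proof.
move=> T T' TT'; apply: val_inj; apply/ffunP => c.
pose c' := cell_at T' (T c).
have rc : row_of c' = row_of c.
  by rewrite -nth_syt_word -TT' nth_syt_word syt_cellK.
rewrite -/(syt_entry T c) -/(syt_entry T' c).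
suff cc : c' = c by rewrite -[in RHS]cc cell_atK.
apply: cell_eqP => //; rewrite -(count_syt_word_col T c) -(count_syt_word_col T' c').
by rewrite rc TT' cell_atK.
Qed.

Lemma syt_word_lattice T : lattice_word (nth 0 la) (syt_word T).
Proof.
split=> [i|m i].
  rewrite -[X in count_mem i X](take_size (syt_word T)) size_syt_word count_syt_word -sum1_card.
  rewrite (eq_bigl (fun c => (row_of c == i) && xpredT (col_of c))) => [|c].
    by rewrite (sum_row i xpredT) sum1_card card_ord.
  by rewrite inE ltn_ord andbT.
rewrite !count_syt_word.
(* The map to the cell just above injects row [i.+1] into row [i] and decreases entries. *)
have /boolp.choice[up upP] : forall c, exists c', row_of c = i.+1 -> row_of c' = i /\ col_of c' = col_of c.
  move=> c; have [rc|rc] := eqVneq (row_of c) i.+1; last by exists c => rc'; rewrite rc' eqxx in rc.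
  have : col_of c < nth 0 la i.
    by apply: leq_trans (col_lt c) _; rewrite rc; exact: parts_is_part.1.
  by move=> /ex_cell[c' c'P]; exists c'.
rewrite -(card_in_imset (f := up)) => [|c d]; last first.
  rewrite !inE => /andP[_ /eqP rc] /andP[_ /eqP rd] ucd.
  have [[_ cc] [_ dd]] := (upP c rc, upP d rd).
  by apply: cell_eqP; rewrite ?rc ?rd // -cc ucd.
apply: subset_leq_card; apply/fintype.subsetP => c' /imsetP[c].
rewrite !inE => /andP[Tc /eqP rc] ->; have [rcu ccu] := upP c rc.
rewrite rcu eqxx andbT (leq_trans _ Tc) // ltnS ltnW // syt_col // rcu rc.
exact: ltnSn.
Qed.

Lemma syt_word_onto w : size w = n -> lattice_word (nth 0 la) w -> exists T, syt_word T = w.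
Proof.
move=> sw [cw lw].
(* Each position is put into the first free cell of the row named by its letter. *)
have /boolp.choice[ka kaP] : forall p : 'I_n, exists c, row_of c = nth 0 w p /\
    col_of c = count_mem (nth 0 w p) (take p w).
  move=> p; apply: ex_cell; rewrite -cw -[X in _ < count_mem _ X](take_size w).
  by apply: count_take_lt; rewrite sw.
have ka_lt p p' : row_of (ka p) = row_of (ka p') -> (col_of (ka p) < col_of (ka p')) -> p < p'.
  have [[-> ->] [-> ->]] := (kaP p, kaP p') => rr cc; rewrite ltnNge; apply/negP => pp.
  by move: cc; rewrite rr ltnNge count_take_le.
have ka_inj : injective ka.
  move=> p p' kk; apply/val_inj => /=; case: (ltngtP p p') => // pp.
    have := @count_take_lt w p p' pp; rewrite sw => /(_ (ltn_ord p)).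
    have [[r1 <-] [r2 c2]] := (kaP p, kaP p').
    by rewrite -r1 kk r2 -c2 ltnn.
  have := @count_take_lt w p' p pp; rewrite sw => /(_ (ltn_ord p')).
  have [[r1 c1] [r2 <-]] := (kaP p, kaP p').
  by rewrite -r2 -kk r1 -c1 ltnn.
have [g kaK gK] : bijective ka by apply: inj_card_bij; rewrite ?card_cell ?card_ord.
pose t : filling la := [ffun c => g c].
have st : standard t.
  apply/and4P; split.
  - by apply/injectiveP => c d; rewrite !ffunE => /(can_inj gK).
  - by apply/forallP => p; apply/existsP; exists (ka p); rewrite ffunE kaK.
  - apply/forallP => c; apply/forallP => d; apply/implyP => /andP[/eqP rcd ccd].
    by rewrite /entry !ffunE ltnS; apply: ka_lt; rewrite !gK.
  - apply/forallP => c; apply/forallP => d; apply/implyP => /andP[/eqP ccd rcd].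
    rewrite /entry !ffunE ltnS ltnNge; apply/negP => gg.
    (* If [d] below [c] were filled first, the prefix ending at [g d] would hold more than
       [col_of d] letters of the lower row, hence by the ballot condition as many of the upper row.
       But fewer than [g c + 1] letters yield only [col_of c] of those. *)
    have [[rc cc] [rd cd]] := (kaP (g c), kaP (g d)); rewrite !gK in rc cc rd cd.
    have lat i j m : i <= j -> count_mem j (take m w) <= count_mem i (take m w).
      elim: j => [|j IH]; first by rewrite leqn0 => /eqP ->.
      by rewrite leq_eqVlt => /predU1P[->//|/IH]; apply: leq_trans; exact: lw.
    have dc : g d < g c.
      rewrite ltn_neqAle gg andbT; apply: contraTneq rcd => /val_inj/(can_inj gK) ->.
      by rewrite ltnn.
    have : (col_of c).+1 <= col_of c.
      rewrite {2}cc {1}ccd cd -rd; apply: (@leq_trans (count_mem (row_of d) (take (g d).+1 w))).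
        by rewrite rd; apply: count_take_lt => //; rewrite sw.
      apply: leq_trans (lat _ _ _ (ltnW rcd)) _; rewrite -rc.
      exact: count_take_le.
    by rewrite ltnn.
exists (MkSYT st); apply: (@eq_from_nth _ 0); rewrite size_syt_word ?sw // => p pn.
rewrite (nth_syt_word _ (Ordinal pn)).
have -> : cell_at (MkSYT st) (Ordinal pn) = ka (Ordinal pn).
  by apply: (@syt_inj (MkSYT st)); rewrite cell_atK /syt_entry /= /t ffunE kaK.
by case: (kaP (Ordinal pn)).
Qed.

Lemma descentE T i (i0 : 0 < i) (il : i < n) :
  descent T i = (nth 0 (syt_word T) i.-1 < nth 0 (syt_word T) i).
Proof.
have i1 : i.-1 < n by lia.
rewrite (nth_syt_word T (Ordinal il)) (nth_syt_word T (Ordinal i1)).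
apply/existsP/idP => [[c /existsP[d /and3P[/eqP Tc /eqP Td]]]|H].
  suff [-> ->] : cell_at T (Ordinal i1) = c /\ cell_at T (Ordinal il) = d by [].
  by split; apply: (@syt_inj T); rewrite cell_atK; apply/val_inj => /=; rewrite -?Tc //; case: Td => ->.
exists (cell_at T (Ordinal i1)); apply/existsP; exists (cell_at T (Ordinal il)).
by rewrite /entry -!/(syt_entry T _) !cell_atK /= prednK // !eqxx.
Qed.

Lemma maj_syt_word T : maj T = word_maj (syt_word T).
Proof.
rewrite /maj /word_maj size_syt_word big_nat_cond [RHS]big_nat_cond.
apply: eq_bigl => i; rewrite -/n; case: (boolP (0 < i < n)) => //= /andP[i1 il].
exact: descentE.
Qed.

Lemma syt_maj_gf (F : fieldType) (q : F) :
  (\sum_(T : SYT la) q ^+ maj T = word_maj_gf q (size la) n (nth 0 la) 0)%R.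
Proof.
have lp := parts_is_part; have ln := sum_parts.
rewrite word_maj_gfE; under [RHS]eq_bigr do rewrite ltn0 muln0 addn0.
rewrite (perm_big (map syt_word (enum {: SYT la}))) /=; last first.
  apply: uniq_perm => [||w]; rewrite ?lattice_words_uniq //.
    by rewrite map_inj_uniq ?enum_uniq //; exact: syt_word_inj.
  apply/idP/mapP => [/(lattice_wordsP w lp ln)[sw wl]|[T _ ->]].
    by have [T Tw] := syt_word_onto sw wl; exists T; rewrite ?mem_enum.
  apply/(lattice_wordsP _ lp ln).
  by rewrite size_syt_word; split=> //; exact: syt_word_lattice.
by rewrite big_map big_enum /=; apply: eq_bigr => T _; rewrite maj_syt_word.
Qed.

Lemma card_row0 : #|[pred c : cell la | row_of c == 0]| = head 0 la.
Proof.
rewrite -sum1_card -nth0 (eq_bigl (fun c => (row_of c == 0) && xpredT (col_of c))).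
  by rewrite (sum_row 0 xpredT) sum1_card card_ord.
by move=> c; rewrite inE andbT.
Qed.

Lemma card_col0 : #|[pred c : cell la | col_of c == 0]| = size la.
Proof. by rewrite -sum1_card (sum_col0_fun (fun=> 1)) sum1_card card_ord. Qed.

Let sum_cell_at T (P : pred (cell la)) (f : 'I_n -> nat) :
  (forall i, f i <= if P (cell_at T i) then n else 0) ->
  \sum_i f i <= n * #|P|.
Proof.
move=> fP; rewrite -sum1_card big_distrr /= muln1.
rewrite [X in _ <= X](reindex_onto (cell_at T) T) /=; last by move=> c _; rewrite syt_cellK.
rewrite [X in _ <= X]big_mkcond; apply: leq_sum => i _.
by rewrite cell_atK eqxx andbT; exact: fP.
Qed.

Lemma maj_le T : maj T <= n * (n - head 0 la).
Proof.
rewrite maj_syt_word /word_maj size_syt_word -card_row0.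
have -> : n - #|[pred c : cell la | row_of c == 0]| = #|[pred c : cell la | row_of c != 0]|.
  have := cardC [pred c : cell la | row_of c == 0].
  by rewrite card_cell => <-; rewrite addKn; apply: eq_card => c; rewrite !inE.
apply: leq_trans (sum_cell_at (T := T) (f := fun i : 'I_n => if 0 < nth 0 (syt_word T) i then i : nat else 0) _).
  rewrite -(big_mkord xpredT (fun i => if 0 < nth 0 (syt_word T) i then i else 0)).
  case: (posnP n) => [->|n0]; first by rewrite big_geq.
  rewrite [X in _ <= X]big_ltn // big_mkcond; apply: leq_trans (leq_addl _ _).
  apply: leq_sum => i _; case: ifP => // H.
  by rewrite (leq_ltn_trans _ H).
by move=> i; rewrite nth_syt_word lt0n inE; case: ifP => // _; exact: ltnW.
Qed.

(** The sum of the non-descents is bounded: the entry after a non-descent lies outside of the first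
    column, and each summand is at most [n]. *)
Lemma maj_ge T : \sum_(0 <= i < n) i <= maj T + n * (n - size la).
Proof.
rewrite maj_syt_word /word_maj size_syt_word -card_col0.
have -> : n - #|[pred c : cell la | col_of c == 0]| = #|[pred c : cell la | col_of c != 0]|.
  have := cardC [pred c : cell la | col_of c == 0].
  by rewrite card_cell => <-; rewrite addKn; apply: eq_card => c; rewrite !inE.
pose g i := if (0 < i) && (nth 0 (syt_word T) i <= nth 0 (syt_word T) i.-1) then i else 0.
apply: (@leq_trans (\sum_(1 <= i < n | nth 0 (syt_word T) i.-1 < nth 0 (syt_word T) i) i + \sum_(i < n) g i)).
  rewrite -(big_mkord xpredT g) [in X in _ <= X + _]big_mkcond.
  case: (posnP n) => [->|n0]; first by rewrite big_geq.
  rewrite big_ltn // add0n [X in _ <= _ + X]big_ltn // add0n -big_split /=.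
  rewrite big_nat [X in _ <= X]big_nat; apply: leq_sum => i /andP[i0 _].
  by rewrite /g i0 /=; case: ltnP; rewrite ?addn0.
rewrite leq_add2l; apply: (sum_cell_at (T := T)) => i; rewrite /g inE.
case: ifP => // /andP[i0]; have i1 : i.-1 < n by rewrite (leq_ltn_trans (leq_pred _)).
rewrite nth_syt_word (nth_syt_word T (Ordinal i1)).
set c := cell_at T i; set d := cell_at T _ => cd.
have Tc : T c = i by rewrite cell_atK.
have Td : T d = i.-1 :> nat by rewrite cell_atK.
case: eqP => [c0|_] /=; last exact: ltnW.
suff : T c <= T d by rewrite Tc Td -ltnS prednK // ltnn.
move: cd; rewrite leq_eqVlt => /predU1P[cd|cd].
  by rewrite leqNgt syt_row_lt // c0.
(* If [c] were in the first column, strictly above [d], then the first cell [e] of the row of [d]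
   would give [T c <= T e <= T d]. *)
have [|e [re ce]] := @ex_cell (row_of d) 0; first by apply: leq_ltn_trans (col_lt d).
apply: (@leq_trans (T e)); first by rewrite ltnW // syt_col // ?re // ce.
by rewrite leqNgt syt_row_lt ?re // ce.
Qed.

Lemma head_conj_parts : head 0 (conj_parts la) = size la.
Proof.
rewrite /conj_parts; have := parts_pos la.
case: (parts la) => [//|[|x] s]; first by rewrite in_cons eqxx.
rewrite in_cons negb_or => /andP[_ s0] /=; congr _.+1; apply/eqP; rewrite -all_count.
by apply/allP => y ys; rewrite lt0n; apply: contraNneq s0 => <-.
Qed.

End tableau_words.

(** * Power sums of hook lengths *)

Section cell_sums.
Variable la : intpart.
Let n := sumn la.

Lemma beta_le (i : 'I_(size la)) : beta (size la) (nth 0 la) i <= n.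
Proof.
rewrite /n -sum_parts (bigD1 i) //= /beta leq_add2l.
apply: (@leq_trans (size la).-1); first by have := ltn_ord i; lia.
apply: (@leq_trans (\sum_(j < size la | j != i) 1)).
  by rewrite sum1_card cardC1 card_ord.
by apply: leq_sum => j _; exact: nth_parts_gt0.
Qed.

Lemma nth_parts_mono i j : i <= j -> nth 0 la j <= nth 0 la i.
Proof.
elim: j => [|j IH]; first by rewrite leqn0 => /eqP ->.
rewrite leq_eqVlt => /predU1P[->//|/IH]; apply: leq_trans.
exact: (parts_is_part la).1.
Qed.

(** One of the truncated differences is 0, so this is the square of the content [j - i]. *)
Definition content_sq (i j : nat) : nat := ((i - j) + (j - i)) ^ 2.

Let M := maxn (head 0 la) (head 0 (conj_parts la)).

Lemma aftE : aft la = n - M. Proof. by []. Qed.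

Lemma max_row_col_le : M <= n.
Proof.
rewrite /M head_conj_parts geq_max; apply/andP; split.
  by rewrite -card_row0 /n -card_cell max_card.
by rewrite -card_col0 /n -card_cell max_card.
Qed.

(** For [P] the first row or the first column, whichever is longer: its [M] contents are 0, ...,
    [M - 1] up to sign, and [aft la] cells remain. *)
Let off_line (P : pred (cell la)) (f : nat -> nat -> nat) :
  #|[pred c | P c]| = M ->
  \sum_(c | P c) f (row_of c) (col_of c) = \sum_(j < M) j ^ 2 ->
  (forall c, ~~ P c -> f (row_of c) (col_of c) <= minn M.-1 (aft la) ^ 2) ->
  \sum_(c : cell la) f (row_of c) (col_of c) <= \sum_(j < M) j ^ 2 + aft la * minn M.-1 (aft la) ^ 2.
Proof.
move=> PM fP fC; rewrite (bigID P) /= fP leq_add2l.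
apply: (@leq_trans (\sum_(c : cell la | ~~ P c) minn M.-1 (aft la) ^ 2)); first exact: leq_sum.
rewrite sum_nat_const leq_mul2r; apply/orP; right.
rewrite aftE -PM /n -card_cell -(cardC [pred c | P c]) addKn.
by apply: eq_leq; apply: eq_card => c; rewrite !inE.
Qed.

Let sq_le a b m : a <= m -> b <= m -> ((a - b) + (b - a)) ^ 2 <= m ^ 2.
Proof. by move=> am bm; rewrite leq_exp2r //; lia. Qed.

Lemma sum_content_sq_le :
  \sum_(i < size la) \sum_(j < nth 0 la i) content_sq i j <=
  \sum_(j < M) j ^ 2 + aft la * minn M.-1 (aft la) ^ 2.
Proof.
rewrite -(sum_cell la content_sq).
have pos c : row_of c < size la := ltn_ord (tag c).
have [rM|cM] := leqP (size la) (head 0 la).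
  have ME : M = head 0 la by rewrite /M head_conj_parts; apply/maxn_idPl.
  apply: (@off_line (fun c => row_of c == 0)).
  - by rewrite ME -card_row0.
  - rewrite (eq_bigr (fun c => col_of c ^ 2)); last first.
      by move=> c /eqP ->; rewrite /content_sq sub0n subn0.
    by rewrite (sum_row_fun la 0 (fun j => j ^ 2)) ME nth0.
  - move=> c c0; have cl := col_lt c; have rl := pos c.
    have l0 : nth 0 la (row_of c) <= head 0 la by rewrite -nth0 nth_parts_mono.
    have head_add (f : nat) : f <= \sum_(i < size la | i != 0 :> nat) nth 0 la i -> f <= aft la.
      move=> ff; rewrite aftE ME leq_subRL -?ME ?max_row_col_le // ME /n -sum_parts.
      have l1 : 0 < size la by lia.
      by rewrite (bigD1 (Ordinal l1)) //= -nth0 leq_add2l.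
    have a1 : nth 0 la (row_of c) <= aft la.
      apply: head_add; rewrite (bigD1 (Ordinal rl)) //=; exact: leq_addr.
    have a2 : (size la).-1 <= aft la.
      apply: head_add; apply: (@leq_trans (\sum_(i < size la | i != 0 :> nat) 1)).
        have l1 : 0 < size la by lia.
        by rewrite sum1_card (cardC1 (Ordinal l1)) card_ord.
      by apply: leq_sum => i _; exact: nth_parts_gt0.
    by rewrite /content_sq; apply: sq_le; rewrite leq_min ME; lia.
have ME : M = size la by rewrite /M head_conj_parts; apply/maxn_idPr; exact: ltnW.
apply: (@off_line (fun c => col_of c == 0)).
- by rewrite ME -card_col0.
- rewrite (eq_bigr (fun c => row_of c ^ 2)); last first.
    by move=> c /eqP ->; rewrite /content_sq sub0n subn0 addn0.
  by rewrite (sum_col0_fun la (fun j => j ^ 2)) ME.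
- move=> c c0; have cl := col_lt c; have rl := pos c.
  have l0 : nth 0 la (row_of c) <= head 0 la by rewrite -nth0 nth_parts_mono.
  have aE : aft la = \sum_(i < size la) (nth 0 la i).-1.
    rewrite aftE ME /n -sum_parts -[X in _ - X]card_ord -sum1_card -sumnB.
      by apply: eq_bigr => i _; rewrite subn1.
    by move=> i _; exact: nth_parts_gt0.
  have a1 : (nth 0 la (row_of c)).-1 <= aft la.
    rewrite aE (bigD1 (Ordinal rl)) //=; exact: leq_addr.
  have a2 : row_of c <= aft la.
    rewrite aE -(big_mkord xpredT (fun i => (nth 0 la i).-1)).
    rewrite (@big_cat_nat _ _ _ (row_of c)) //=; last exact: ltnW.
    apply: leq_trans (leq_addr _ _).
    rewrite -[X in X <= _]subn0 -[X in X <= _]muln1 -sum_nat_const_nat.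
    rewrite big_nat [X in _ <= X]big_nat; apply: leq_sum => i /andP[_ ic].
    by have := nth_parts_mono (ltnW ic); lia.
  by rewrite /content_sq; apply: sq_le; rewrite leq_min ME; lia.
Qed.

Lemma sum_content_sq_aft :
  48 * (\sum_(i < size la) \sum_(j < nth 0 la i) content_sq i j) + aft la * n ^ 2 <=
  48 * \sum_(j < n) j ^ 2.
Proof.
have := sum_content_sq_le; set S := \sum_(i < size la) _ => SM.
have Mn := max_row_col_le; set a := aft la in SM *.
have nE : n = M + a by rewrite /a aftE subnKC.
have -> : \sum_(j < n) j ^ 2 = \sum_(j < M) j ^ 2 + \sum_(j < a) (M + j) ^ 2.
  rewrite -!(big_mkord xpredT (fun j => j ^ 2)) (@big_cat_nat _ _ _ M) //=; congr (_ + _).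
  by rewrite -{1}[M]add0n big_addn nE addKn big_mkord; apply: eq_bigr => j _; rewrite addnC.
apply: (@leq_trans (48 * (\sum_(j < M) j ^ 2 + a * minn M.-1 a ^ 2) + a * n ^ 2)).
  by rewrite leq_add2r leq_mul2l SM.
rewrite !mulnDr -addnA leq_add2l.
(* If [n <= 4a], then [a n^2 <= 16 a^3], which is at most 48 times the sum of the [(j+1)^2], and
   [(M-1)^2 + (j+1)^2 <= (M+j)^2]; this is where 48 = 3 * 16 comes from. Otherwise [M > 3a], and
   [48 a^2 + n^2 <= 48 M^2] suffices for each term. *)
have [na|an] := leqP n (4 * a).
  have cube m : m ^ 3 <= 3 * \sum_(j < m) j.+1 ^ 2.
    elim: m => [|m IH]; first by rewrite big_ord0.
    rewrite big_ord_recr /= mulnDr; apply: leq_trans (leq_add IH (leqnn _)); nia.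
  apply: (@leq_trans (48 * (a * M.-1 ^ 2) + 48 * \sum_(j < a) j.+1 ^ 2)).
    apply: leq_add.
      by rewrite !leq_mul2l leq_exp2r // geq_minl !orbT.
    apply: (@leq_trans (16 * a ^ 3)); last by have := cube a; lia.
    have : a * n ^ 2 <= a * (4 * a) ^ 2 by rewrite leq_mul2l leq_exp2r ?na ?orbT.
    by move=> /leq_trans; apply; rewrite expnMn; nia.
  rewrite -mulnDr leq_mul2l /= -[X in X * _ + _]card_ord -sum_nat_const -big_split /=.
  have M0 : 0 < a -> 0 < M.
    rewrite !lt0n; apply: contra_neq => M0.
    have s0 : size la = 0 by move: M0; rewrite /M head_conj_parts; lia.
    have : n = 0 by rewrite /n -sum_parts s0 big_ord0.
    by rewrite nE; lia.
  apply: leq_sum => j _; have := M0 (leq_ltn_trans (leq0n j) (ltn_ord j)).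
  by case: (M) => // m _; rewrite /= addSnnS sqrnD leq_addr.
have aM : a <= M.-1 by lia.
rewrite (minn_idPr aM) -[X in 48 * (X * _) + X * _]card_ord -!sum_nat_const.
rewrite !big_distrr /= -big_split /=; apply: leq_sum => j _; rewrite nE.
have h1 : (3 * a) ^ 2 <= M ^ 2 by rewrite leq_exp2r //; lia.
have h2 : M ^ 2 <= (M + j) ^ 2 by rewrite leq_exp2r // leq_addr.
have h3 : (3 * (M + a)) ^ 2 <= (4 * M) ^ 2 by rewrite leq_exp2r //; lia.
by move: h1 h3; rewrite !expnMn; lia.
Qed.

End cell_sums.

(** * Sums over 1, ..., n compared with sums over the hook lengths *)

Section hook_dominance.
Local Open Scope ring_scope.
Variables (R : realFieldType) (la : intpart).
Let n := sumn la.
Let k := size la.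
Let lp := parts_is_part la.
Let lB := @beta_le la.

Definition hook (p : 'I_n.+1 * 'I_n.+1) := is_hook k (nth 0%N la) p.

Definition hook_defect (f : nat -> R) : R :=
  \sum_(a < n) f a.+1 - \sum_(p | hook p) f (hook_len p).

Lemma card_hooks : #|hook| = n.
Proof. by rewrite (card_hook lp lB) sum_parts. Qed.

Lemma hook_len_gt0 p : hook p -> (0 < hook_len p)%N.
Proof. by case/and3P => _ _; rewrite subn_gt0. Qed.

Lemma card_hooks_ge m : (0 < m)%N -> (m <= n.+1)%N ->
  (#|[pred p | hook p && (m <= hook_len p)%N]| <= n.+1 - m)%N.
Proof.
move=> m0 mn; have := card_long_hook lp lB m0; rewrite sum_parts; exact.
Qed.

Lemma hook_len_le p : hook p -> (hook_len p <= n)%N.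
Proof.
move=> hp; rewrite leqNgt; apply/negP => hn.
have := card_hooks_ge (ltn0Sn n) (leqnn _); rewrite subnn leqn0 => /eqP/card0_eq/(_ p).
by rewrite inE hp hn.
Qed.

Let long m : R := (n - m - #|[pred p | hook p && (m < hook_len p)%N]|)%:R.

(** Abel summation; the terms [f 1] cancel because there are exactly [n] hooks. By [card_hooks_ge]
    the subtraction inside [long m] is not truncated, so defects can be compared through the
    increments of [f]. *)
Lemma hook_defectE (f : nat -> R) :
  hook_defect f = \sum_(1 <= m < n) (f m.+1 - f m) * long m.
Proof.
have tel h : (0 < h <= n)%N -> f h = f 1%N + \sum_(1 <= m < n | (m < h)%N) (f m.+1 - f m).
  move=> /andP[h0 hn].
  rewrite (@big_cat_nat _ _ _ h) //= [X in _ + (_ + X)]big_nat_cond.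
  rewrite [X in _ + (_ + X)]big_pred0 => [|m]; last by lia.
  rewrite addr0 big_nat_cond (eq_bigl (fun m => (1 <= m < h)%N && true)) => [|m]; last by lia.
  by rewrite -big_nat_cond telescope_sumr // subrKC.
rewrite /hook_defect (eq_bigr _ (fun (a : 'I_n) _ => tel a.+1 (ltn_ord a))).
rewrite [X in _ - X](eq_bigr (fun p => f 1%N + \sum_(1 <= m < n | (m < hook_len p)%N) (f m.+1 - f m))); last first.
  by move=> p hp; apply: tel; rewrite hook_len_gt0 // hook_len_le.
rewrite !big_split /= !sumr_const card_ord card_hooks opprD addrACA subrr add0r.
rewrite (eq_bigr (fun a : 'I_n => \sum_(1 <= m < n) if (m < a.+1)%N then f m.+1 - f m else 0)); last first.
  by move=> a _; rewrite big_mkcond.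
rewrite [X in _ - X](eq_bigr (fun p => \sum_(1 <= m < n) if (m < hook_len p)%N then f m.+1 - f m else 0)); last first.
  by move=> p _; rewrite big_mkcond.
rewrite exchange_big [X in _ - X]exchange_big /= -sumrB !big_nat; apply: eq_bigr => m /andP[m1 mn].
rewrite -big_mkcond -big_mkcondr !sumr_const /long natrB; last first.
  by have := @card_hooks_ge m.+1 isT (ltnW mn); rewrite subSS.
rewrite mulrBr !mulr_natr; congr (_ *+ _ - _ *+ _).
  rewrite -sum1_card -(big_mkord (fun a => m <= a)%N (fun=> 1%N)).
  rewrite (@big_cat_nat _ _ _ m) ?(ltnW mn) //=.
  rewrite big_nat_cond big_pred0 => [|j]; last by lia.
  rewrite add0n big_nat_cond (eq_bigl (fun j => (m <= j < n)%N && true)) => [|j]; last by lia.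
  by rewrite -big_nat_cond sum_nat_const_nat muln1.
Qed.

Lemma hook_defect_le (f g : nat -> R) :
  (forall m, (0 < m < n)%N -> `|f m.+1 - f m| <= g m.+1 - g m) ->
  `|hook_defect f| <= hook_defect g.
Proof.
move=> fg; rewrite !hook_defectE.
apply: le_trans (ler_norm_sum _ _ _) _; rewrite !big_nat; apply: ler_sum => m mn.
by rewrite normrM [`|long m|]ger0_norm ?ler0n // ler_wpM2r ?ler0n // fg.
Qed.

Let sqsum b : R := \sum_(a < b) a.+1%:R ^+ 2.

Lemma sqsumE b : sqsum b = b%:R * (b%:R + 1) * (2 * b%:R + 1) / 6.
Proof.
elim: b => [|b IH]; first by rewrite /sqsum big_ord0 mul0r !mul0r.
by rewrite /sqsum big_ord_recr /= -/(sqsum b) IH -[b.+1]addn1 natrD; field.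
Qed.

Let sum_content i b : \sum_(j < b) (j%:R - i%:R) ^+ 2 =
  b%:R * (b%:R - 1) * (2 * b%:R - 1) / 6 - i%:R * b%:R * (b%:R - 1) + i%:R ^+ 2 * b%:R :> R.
Proof.
elim: b => [|b IH]; first by rewrite big_ord0 !(mul0r, mulr0) subr0 addr0.
by rewrite big_ord_recr /= IH -[b.+1]addn1 natrD; field.
Qed.

(** Lagrange's identity, obtained by symmetrizing the sum over [i < j]. *)
Let sum_sq_diff (l : nat -> nat) : is_part k l ->
  (forall i : 'I_k, (beta k l i <= n)%N) ->
  \sum_(i < k) \sum_(j < k | (i < j)%N) (beta k l i - beta k l j)%:R ^+ 2 =
  k%:R * \sum_(i < k) (beta k l i)%:R ^+ 2 - (\sum_(i < k) (beta k l i)%:R) ^+ 2 :> R.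
Proof.
move=> llp llB; set b : 'I_k -> R := fun i => (beta k l i)%:R.
have -> : \sum_(i < k) \sum_(j < k | (i < j)%N) (beta k l i - beta k l j)%:R ^+ 2 =
    \sum_(i < k) \sum_(j < k) (if (i < j)%N then (b i - b j) ^+ 2 else 0).
  apply: eq_bigr => i _; rewrite big_mkcond; apply: eq_bigr => j _.
  by case: ifP => // ij; rewrite natrB // ltnW // (beta_lt llp).
set S := LHS.
have SS : S + S = \sum_(i < k) \sum_(j < k) (b i - b j) ^+ 2.
  rewrite {2}/S exchange_big /= -big_split /=; apply: eq_bigr => i _.
  rewrite -big_split /=; apply: eq_bigr => j _.
  case: (ltngtP i j) => [||/val_inj ->]; rewrite ?addr0 ?add0r //; first by move=> _; ring.
  by rewrite subrr expr0n.
have : S + S = 2 * (k%:R * \sum_(i < k) b i ^+ 2 - (\sum_(i < k) b i) ^+ 2).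
  rewrite SS (eq_bigr (fun i => k%:R * b i ^+ 2 + \sum_j b j ^+ 2 - 2 * b i * \sum_j b j)).
    rewrite sumrB big_split /= sumr_const card_ord -mulr_sumr -mulr_suml -mulr_sumr -mulr_natl.
    by ring.
  move=> i _; rewrite (eq_bigr (fun j => b i ^+ 2 + b j ^+ 2 - 2 * b i * b j)) => [|j _]; last by ring.
  by rewrite sumrB big_split /= sumr_const card_ord -mulr_sumr [k%:R * _]mulr_natl.
by rewrite -/(b _) => E; apply: (@mulfI _ 2); rewrite ?pnatr_eq0 // -E mulr_natl mulr2n.
Qed.

(* The identity [sum of squared hook lengths = n ^ 2 + sum of squared contents]. *)
Lemma hook_defect_sq : hook_defect (fun a => a%:R ^+ 2) =
  (\sum_(j < n) j ^ 2)%N%:R -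
  (\sum_(i < k) \sum_(j < nth 0%N la i) content_sq i j)%N%:R.
Proof.
pose b (i : 'I_k) : R := (beta k (nth 0%N la) i)%:R.
pose d (i : 'I_k) : R := (k - i.+1)%:R.
pose C (i : 'I_k) : R := \sum_(j < nth 0%N la i) (j%:R - i%:R) ^+ 2.
have zB (i : 'I_k) : (beta k (fun=> 0%N) i <= n)%N.
  by apply: leq_trans (lB i); rewrite /beta add0n leq_addl.
have zp : is_part k (fun=> 0%N) by [].
(* The empty partition has no hooks, so this evaluates the sum of the constants in [row] without
   computing it. *)
have Hz := big_hook zp zB +%R (fun a => a%:R ^+ 2 : R).
rewrite /= big_pred0 in Hz; last first.
  have /card0_eq H0 : #|is_hook k (fun=> 0%N) : pred ('I_n.+1 * 'I_n.+1)| = 0%N by rewrite card_hook // big1.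
  by move=> p; exact: H0.
rewrite add0r sum_sq_diff // in Hz.
have Hb := big_hook lp lB +%R (fun a => a%:R ^+ 2 : R).
rewrite /= sum_sq_diff // in Hb.
have bd i : b i = (nth 0%N la i)%:R + d i by rewrite /b /d /beta natrD.
have sb : \sum_i b i = n%:R + \sum_i d i.
  by rewrite (eq_bigr _ (fun i _ => bd i)) big_split /= -natr_sum sum_parts.
have di (i : 'I_k) : d i = k%:R - i%:R - 1 by rewrite /d natrB // -[i.+1]addn1 natrD opprD addrA.
have sd : 2 * \sum_i d i = k%:R ^+ 2 - k%:R.
  have -> : \sum_i d i = \sum_(i < k) i%:R by rewrite [RHS](reindex_inj rev_ord_inj).
  have H m : 2 * \sum_(i < m) i%:R = m%:R ^+ 2 - m%:R :> R.
    elim: m => [|m IH]; first by rewrite big_ord0 mulr0 expr0n subrr.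
    by rewrite big_ord_recr /= mulrDr IH -[m.+1]addn1 natrD; ring.
  exact: H.
(* The cubic terms in [b i] cancel. What remains is quadratic, plus a constant that depends only on
   [i] and [k]. *)
have row (i : 'I_k) : sqsum (beta k (nth 0%N la) i) - C i =
    k%:R * b i ^+ 2 + (k%:R - k%:R ^+ 2) * b i + (sqsum (k - i.+1) - k%:R * d i ^+ 2 - (k%:R - k%:R ^+ 2) * d i).
  by rewrite /C sum_content !sqsumE -/(b i) -/(d i) !bd !di; field.
have rows : \sum_(i < k) sqsum (beta k (nth 0%N la) i) = \sum_i C i +
   (k%:R * \sum_i b i ^+ 2 + (k%:R - k%:R ^+ 2) * \sum_i b i + (\sum_(i < k) sqsum (k - i.+1) - k%:R * \sum_i d i ^+ 2 - (k%:R - k%:R ^+ 2) * \sum_i d i)).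
  rewrite !mulr_sumr -!sumrB -!big_split /=; apply: eq_bigr => i _.
  by rewrite -row; ring.
have contE : (\sum_(i < k) \sum_(j < nth 0%N la i) content_sq i j)%N%:R = \sum_i C i.
  rewrite natr_sum; apply: eq_bigr => i _; rewrite natr_sum; apply: eq_bigr => j _.
  rewrite /content_sq natrX natrD; case: (leqP i j) => ij.
    by have -> : (i - j = 0)%N; [lia | rewrite add0r natrB].
  have -> : (j - i = 0)%N by lia.
  rewrite addr0 natrB; [by ring | exact: ltnW].
have sqE : (\sum_(j < n) j ^ 2)%N%:R = sqsum n - n%:R ^+ 2.
  rewrite sqsumE; elim: (n) => [|m IH]; first by rewrite big_ord0 expr0n !mul0r subrr.
  by rewrite big_ord_recr /= natrD IH natrX -[m.+1]addn1 natrD; field.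
rewrite /hook_defect contE sqE -/(sqsum n).
have -> : \sum_(p | hook p) (hook_len p)%:R ^+ 2 = \sum_(i < k) sqsum (beta k (nth 0%N la) i) -
   (k%:R * \sum_i b i ^+ 2 - (\sum_i b i) ^+ 2).
  by rewrite -[X in X - _]Hb addrK.
have zz : \sum_(i < k) sqsum (k - i.+1) = k%:R * \sum_i d i ^+ 2 - (\sum_i d i) ^+ 2.
  by rewrite -[LHS]Hz.
rewrite rows zz sb; have -> : k%:R - k%:R ^+ 2 = - (2 * \sum_i d i) by rewrite sd opprB.
by ring.
Qed.

Lemma hook_defect_sq_ge : (aft la)%:R * n%:R ^+ 2 / 48 <= hook_defect (fun a => a%:R ^+ 2).
Proof.
rewrite hook_defect_sq ler_pdivrMr ?ltr0n //.
have := sum_content_sq_aft la; rewrite -(ler_nat R) natrD !natrM expr2 -/n -/k.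
by lra.
Qed.

End hook_dominance.

(** * Trigonometric inequalities *)

Section trigonometric_bounds.
Local Open Scope ring_scope.
Variable R : realType.
Implicit Types x y : R.

Lemma ge0_of_derive (f df : R -> R) : f 0 = 0 ->
  (forall x, is_derive x 1 f (df x)) -> (forall x, 0 <= x -> 0 <= df x) ->
  forall x, 0 <= x -> 0 <= f x.
Proof.
move=> f0 fd df0 x x0.
have [|c] := @MVT_segment R f df 0 x x0 (fun y _ => fd y).
  by apply: derivable_within_continuous => y _; exact: ex_derive.
rewrite in_itv /= f0 !subr0 => /andP[c0 _] ->.
by rewrite mulr_ge0 // df0.
Qed.

Lemma sin_le_id x : 0 <= x -> sin x <= x.
Proof.
rewrite -[sin x <= x]subr_ge0; apply: (@ge0_of_derive (id - sin) (fun x => 1 - cos x)).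
- by rewrite !fctE sin0 subr0.
- by move=> {}x _; rewrite subr_ge0 cos_le1.
Qed.

Lemma cos_ge2 x : 0 <= x -> 1 - x ^+ 2 / 2 <= cos x.
Proof.
move=> x0; have := @ge0_of_derive (cos - cst 1 + 2^-1 *: id ^+ 2) (fun x => x - sin x) _ _ _ x x0.
rewrite !fctE /GRing.scale /= => H; have : 0 <= cos x - 1 + 2^-1 * x ^+ 2; last by lra.
apply: H.
- by rewrite cos0 expr0n mulr0 subrr addr0.
- move=> {x0}x /=; apply: is_derive_eq; rewrite /GRing.scale /= subr0; lra.
- by move=> {x0}x x0; rewrite subr_ge0 sin_le_id.
Qed.

Lemma sin_ge3 x : 0 <= x -> x - x ^+ 3 / 6 <= sin x.
Proof.
move=> x0; have := @ge0_of_derive (sin - id + 6^-1 *: id ^+ 3) (fun x => cos x - 1 + x ^+ 2 / 2) _ _ _ x x0.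
rewrite !fctE /GRing.scale /= => H; have : 0 <= sin x - x + 6^-1 * x ^+ 3; last by lra.
apply: H.
- by rewrite sin0 expr0n mulr0 subrr addr0.
- move=> {x0}x /=; apply: is_derive_eq; rewrite /GRing.scale /=; lra.
- by move=> {x0}x /cos_ge2; lra.
Qed.

Lemma cos_le4 x : 0 <= x -> cos x <= 1 - x ^+ 2 / 2 + x ^+ 4 / 24.
Proof.
move=> x0; have := @ge0_of_derive (cst 1 - 2^-1 *: id ^+ 2 + 24^-1 *: id ^+ 4 - cos)
  (fun x => sin x - x + x ^+ 3 / 6) _ _ _ x x0.
rewrite !fctE /GRing.scale /= => H; have : 0 <= 1 - 2^-1 * x ^+ 2 + 24^-1 * x ^+ 4 - cos x; last by lra.
apply: H.
- by rewrite cos0 !expr0n !mulr0 subr0 addr0 subrr.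
- move=> {x0}x /=; apply: is_derive_eq; rewrite /GRing.scale /=; lra.
- by move=> {x0}x /sin_ge3; lra.
Qed.

Lemma sin_le5 x : 0 <= x -> sin x <= x - x ^+ 3 / 6 + x ^+ 5 / 120.
Proof.
move=> x0; have := @ge0_of_derive (id - 6^-1 *: id ^+ 3 + 120^-1 *: id ^+ 5 - sin)
  (fun x => 1 - x ^+ 2 / 2 + x ^+ 4 / 24 - cos x) _ _ _ x x0.
rewrite !fctE /GRing.scale /= => H; have : 0 <= x - 6^-1 * x ^+ 3 + 120^-1 * x ^+ 5 - sin x; last by lra.
apply: H.
- by rewrite sin0 !expr0n !mulr0 subr0 addr0 subrr.
- move=> {x0}x /=; apply: is_derive_eq; rewrite /GRing.scale /=; lra.
- by move=> {x0}x /cos_le4; lra.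
Qed.

Lemma cos_bound x : `|cos x - 1 + x ^+ 2 / 2| <= x ^+ 4 / 24.
Proof.
have -> : cos x - 1 + x ^+ 2 / 2 = cos `|x| - 1 + `|x| ^+ 2 / 2.
  by rewrite cos_norm real_normK ?num_real.
have -> : x ^+ 4 = `|x| ^+ 4 by rewrite -normrX ger0_norm // (exprM x 2 2) sqr_ge0.
have := cos_ge2 (normr_ge0 x); have := cos_le4 (normr_ge0 x).
by rewrite ler_norml; lra.
Qed.

Lemma cos_bound2 x : `|cos x - 1| <= x ^+ 2 / 2.
Proof.
have -> : cos x - 1 = cos `|x| - 1 by rewrite cos_norm.
have -> : x ^+ 2 = `|x| ^+ 2 by rewrite real_normK ?num_real.
have := cos_ge2 (normr_ge0 x); have := cos_le1 `|x|.
have := sqr_ge0 `|x|.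
by rewrite ler_norml; lra.
Qed.

Lemma sin_bound x : `|sin x - x| <= `|x| ^+ 3 / 6.
Proof.
have -> : `|sin x - x| = `|sin `|x| - `|x| |.
  case: (ger0P x) => // x0; by rewrite sinN opprK [- sin x + _]addrC distrC.
have := sin_ge3 (normr_ge0 x); have := sin_le_id (normr_ge0 x).
have : 0 <= `|x| ^+ 3 by rewrite exprn_ge0.
by rewrite ler_norml; lra.
Qed.

Lemma sin_gt0_01 x : 0 < x <= 1 -> 0 < sin x.
Proof.
move=> /andP[x0 x1]; apply: lt_le_trans (sin_ge3 (ltW x0)).
have x2 : x ^+ 2 <= 1 by rewrite expr_le1 // ltW.
by rewrite (_ : x - _ = x * (1 - x ^+ 2 / 6)) ?mulr_gt0 //; [lra | field].
Qed.

(** The logarithm of [sin x / x] without its quadratic term, so of fourth order at 0. *)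
Definition lnsinc x := ln (sin x / x) + x ^+ 2 / 6.

(** Mean value theorem. The derivative [cot c - 1/c + c/3] has a numerator of size at most [5/6 c^5]
    by the Taylor bounds, over [c sin c >= 5/6 c^2]. *)
Lemma lnsinc_diff x y : 0 < x -> x <= y -> y <= 1 ->
  `|lnsinc y - lnsinc x| <= (y - x) * y ^+ 3.
Proof.
move=> x0 xy y1.
pose df x : R := (cos x / x - sin x / x ^+ 2) / (sin x / x) + x / 3.
have dlnsinc (z : R) : 0 < z <= 1 -> is_derive z 1 lnsinc (df z).
  move=> z01; have z0 : 0 < z by case/andP: z01.
  have sz := sin_gt0_01 z01.
  have d1 : is_derive z 1 (fun z : R => z^-1) (- z ^- 2).
    by have := @is_deriveV R id z 1 1 (lt0r_neq0 z0) (is_derive_id _ _); rewrite /GRing.scale /= mulr1.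
  have d2 : is_derive z 1 (sin * (fun z : R => z^-1)) (cos z / z - sin z / z ^+ 2).
    by apply: is_derive_eq; rewrite /GRing.scale /= addrC mulrN [z^-1 * _]mulrC.
  have sz0 : 0 < (sin * (fun z : R => z^-1)) z by rewrite divr_gt0.
  have d3 := is_derive1_comp (is_derive1_ln sz0) d2.
  have d4 : is_derive z 1 (@ln R \o (sin * (fun z : R => z^-1)) + 6^-1 *: id ^+ 2) (df z).
    apply: is_derive_eq; rewrite /df /GRing.scale /=.
    rewrite mulrC expr1 mulr1 -[(sin * _) z]/(sin z / z); congr (_ + _); lra.
  suff -> : lnsinc = @ln R \o (sin * (fun z : R => z^-1)) + 6^-1 *: id ^+ 2 by [].
  by apply/funext => t; rewrite /lnsinc !fctE /= /GRing.scale /=; lra.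
have in01 (z : R) : x <= z -> z <= y -> 0 < z <= 1.
  by move=> xz zy; rewrite (lt_le_trans x0 xz) (le_trans zy y1).
have [z||c] := @MVT_segment R lnsinc df x y xy.
- rewrite in_itv /= => /andP[xz zy]; exact: dlnsinc (in01 _ (ltW xz) (ltW zy)).
- apply: derivable_within_continuous => z; rewrite in_itv /= => /andP[xz zy].
  by have [] := dlnsinc _ (in01 _ xz zy).
rewrite in_itv /= => /andP[xc cy] ->; rewrite mulrC normrM ger0_norm ?subr_ge0 //.
rewrite ler_wpM2l ?subr_ge0 //.
have c01 := in01 _ xc cy; have /andP[c0 c1] := c01.
apply: (@le_trans _ _ (c ^+ 3)); last by rewrite lerXn2r // nnegrE ltW // (lt_le_trans c0).
have sc := sin_gt0_01 c01.
have -> : df c = (c * cos c - sin c + c ^+ 2 * sin c / 3) / (c * sin c).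
  by rewrite /df; field; rewrite !gt_eqF.
rewrite normrM [`|_^-1|]gtr0_norm ?invr_gt0 ?mulr_gt0 // ler_pdivrMr ?mulr_gt0 //.
have h1 := cos_ge2 (ltW c0); have h2 := cos_le4 (ltW c0).
have h3 := sin_ge3 (ltW c0); have h4 := sin_le5 (ltW c0); have h5 := sin_le_id (ltW c0).
have c5 : 0 < c ^+ 5 by rewrite exprn_gt0.
have b1 : c * (1 - c ^+ 2 / 2) <= c * cos c by rewrite ler_pM2l.
have b2 : c * cos c <= c * (1 - c ^+ 2 / 2 + c ^+ 4 / 24) by rewrite ler_pM2l.
have b3 : c ^+ 2 * (c - c ^+ 3 / 6) <= c ^+ 2 * sin c by rewrite ler_pM2l ?exprn_gt0.
have b4 : c ^+ 2 * sin c <= c ^+ 2 * c by rewrite ler_pM2l ?exprn_gt0.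
have b5 : c ^+ 3 * (c * (c * (5 / 6))) <= c ^+ 3 * (c * sin c).
  rewrite ler_pM2l ?exprn_gt0 // ler_pM2l //; apply: le_trans h3.
  have c2 : c ^+ 2 <= 1 by rewrite expr_le1 // ltW.
  have : c * c ^+ 2 <= c * 1 by rewrite ler_pM2l.
  rewrite -exprS; lra.
have e1 : c * (1 - c ^+ 2 / 2) = c - c ^+ 3 / 2 by rewrite mulrBr mulr1 mulrA -exprS.
have e2 : c * (1 - c ^+ 2 / 2 + c ^+ 4 / 24) = c - c ^+ 3 / 2 + c ^+ 5 / 24 by field.
have e3 : c ^+ 2 * (c - c ^+ 3 / 6) = c ^+ 3 - c ^+ 5 / 6 by field.
have e4 : c ^+ 2 * c = c ^+ 3 by rewrite -exprSr.
have e5 : c ^+ 3 * (c * (c * (5 / 6))) = c ^+ 5 * (5 / 6) by field.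
rewrite e1 in b1; rewrite e2 in b2; rewrite e3 in b3; rewrite e4 in b4; rewrite e5 in b5.
by rewrite ler_norml; lra.
Qed.

Lemma expR_bound x : `|x| <= 1 / 2 -> `|expR x - 1 - x| <= 2 * x ^+ 2.
Proof.
rewrite ler_norml => /andP[x1 x2]; have h1 := expR_ge1Dx x; have h2 := expR_ge1Dx (- x).
have h3 : expR x <= (1 - x)^-1.
  by rewrite -[expR x]invrK -expRN lef_pV2 ?posrE ?expR_gt0 //; lra.
have h4 : (1 - x)^-1 <= 1 + x + 2 * x ^+ 2.
  rewrite -[X in X <= _]mul1r ler_pdivrMr; last by lra.
  rewrite (_ : (1 + x + _) * _ = 1 + x ^+ 2 * (1 - 2 * x)); last by ring.
  by rewrite lerDl mulr_ge0 ?sqr_ge0 //; lra.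
by rewrite ler_norml; have := sqr_ge0 x; lra.
Qed.

(** Serves to compare coefficients as [t] tends to 0 without differentiating. *)
Lemma le_small_eq0 (a C d : R) : 0 < d -> (forall t, 0 < t -> t <= d -> `|a| <= C * t) -> a = 0.
Proof.
move=> d0 H; apply/eqP; rewrite -normr_le0; apply/ler_addgt0Pl => e e0; rewrite addr0.
have C0 : 0 < `|C| + 1 by rewrite ltr_wpDl.
pose t := Num.min d (e / (`|C| + 1)).
have t0 : 0 < t by rewrite lt_min d0 divr_gt0.
apply: le_trans (H t t0 _) _; first by rewrite ge_min lexx.
apply: (@le_trans _ _ ((`|C| + 1) * t)).
  by apply: ler_wpM2r; [exact: ltW | rewrite (le_trans (ler_norm C)) // lerDl].
by rewrite mulrC -ler_pdivlMr // ge_min lexx orbT.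
Qed.

End trigonometric_bounds.

(** * The characteristic function of maj *)

Section maj_characteristic_function.
Local Open Scope ring_scope.
Local Open Scope complex_scope.
Variables (R : realType) (la : intpart).
Let n := sumn la.
Let k := size la.
Let N := #|{: SYT la}|.

Definition cis (x : R) : R[i] := cos x +i* sin x.

Lemma cis0 : cis 0 = 1.
Proof. by rewrite /cis cos0 sin0. Qed.

Lemma cisD x y : cis (x + y) = cis x * cis y.
Proof.
by apply/eqP; rewrite eq_complex /cis /= cosD sinD eqxx /= [cos x * sin y + _]addrC.
Qed.

Lemma cisX x m : cis x ^+ m = cis (m%:R * x).
Proof.
elim: m => [|m IH]; first by rewrite expr0 mul0r cis0.
by rewrite exprS IH -cisD -[m.+1]add1n natrD mulrDl mul1r.
Qed.

Lemma cis_neq0 x : cis x != 0.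
Proof.
apply/eqP => cx0; have := cisD x (- x); rewrite subrr cis0 cx0 mul0r.
by move/eqP; rewrite oner_eq0.
Qed.

Lemma subr1_cis x : 1 - cis x = (0 +i* (- 2)) * (cis (x / 2) * (sin (x / 2))%:C).
Proof.
have x2 : x = x / 2 *+ 2 by rewrite -mulr_natr divfK ?pnatr_eq0.
have cx : cos x = 1 - 2 * sin (x / 2) ^+ 2.
  by rewrite [in LHS]x2 cos_mulr2n cos2sin2; ring.
have sx : sin x = 2 * (cos (x / 2) * sin (x / 2)) by rewrite [in LHS]x2 sin_mulr2n mulr_natl.
apply/eqP; rewrite eq_complex /cis /= cx sx; apply/andP; split; apply/eqP; ring.
Qed.

Lemma prod_cis (I : finType) (P : pred I) (f : I -> R) :
  \prod_(i | P i) cis (f i) = cis (\sum_(i | P i) f i).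
Proof. by rewrite (big_morph cis cisD cis0). Qed.

Let prod_expR (I : finType) (P : pred I) (f : I -> R) :
  \prod_(i | P i) expR (f i) = expR (\sum_(i | P i) f i).
Proof. by elim/big_rec2: _ => [|i x y _ ->]; rewrite ?expR0 // expRD. Qed.

Lemma prod_realC (I : finType) (P : pred I) (f : I -> R) :
  \prod_(i | P i) (f i)%:C = (\prod_(i | P i) f i)%:C.
Proof. by rewrite rmorph_prod. Qed.

(** The phase of Stanley's quotient at [q = exp (i t)]: the explicit power of [q], plus the half
    angles in [1 - q^a = -2i q^(a/2) sin (a t / 2)]. The factors [-2i] cancel because there are [n]
    hooks. By [sum_maj] this is the mean. *)
Definition maj_center : R :=
  (vandermonde_exp k (nth 0%N la))%:R - (vandermonde_exp k (fun=> 0%N))%:R +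
  (\sum_(a < n) a.+1%:R - \sum_(p | @hook la p) (hook_len p)%:R) / 2.

Let Y (T : SYT la) : R := (maj T)%:R - maj_center.
Let SA t : R := \prod_(a < n) sin (a.+1%:R * t / 2).
Let SH t : R := \prod_(p | @hook la p) sin ((hook_len p)%:R * t / 2).

(** On this range the sines are positive, so no [1 - q ^ a] vanishes, and [lnsinc_diff] applies. *)
Let arg_in01 (t : R) m : 0 < t -> t * n%:R <= 2 -> (0 < m <= n)%N -> 0 < m%:R * t / 2 <= 1.
Proof.
move=> t0 tn /andP[m0 mn]; rewrite divr_gt0 ?mulr_gt0 ?ltr0n //=.
rewrite ler_pdivrMr // mul1r mulrC; apply: le_trans tn.
by rewrite ler_pM2l // ler_nat.
Qed.

Let cis_sum t : 0 < t -> t * n%:R <= 2 ->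
  (\sum_(T : SYT la) cis (t * Y T)) * (SH t)%:C = (SA t)%:C.
Proof.
move=> t0 tn; pose q := cis t; pose K : R[i] := 0 +i* (- 2).
have K0 : K != 0 by rewrite eq_complex /= oppr_eq0 pnatr_eq0 andbF.
have q0 : q != 0 := cis_neq0 t.
have zE a : 1 - q ^+ a = K * (cis (a%:R * t / 2) * (sin (a%:R * t / 2))%:C).
  by rewrite /q cisX subr1_cis.
have qB a : (0 < a <= n)%N -> 1 - q ^+ a != 0.
  move=> an; rewrite zE !mulf_neq0 ?cis_neq0 // -(rmorph0 (real_complex R)).
  by rewrite (inj_eq (@complexI _)) gt_eqF // sin_gt0_01 // arg_in01.
have := word_maj_gf_hook q0 qB (parts_is_part la) (sum_parts la) (@beta_le la) (leqnn n).
rewrite -syt_maj_gf /qpoch.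
rewrite (eq_bigr _ (fun (a : 'I_n) _ => zE a.+1)).
rewrite [X in _ * (_ * X)](eq_bigr _ (fun p _ => zE (hook_len p))).
rewrite !big_split /= !prod_cis !prod_realC !prodr_const card_ord.
rewrite -/(hook) card_hooks -/(SA t) -/(SH t).
rewrite /q !cisX -!mulr_suml.
pose A : R := \sum_(a < n) a.+1%:R; pose H : R := \sum_(p | @hook la p) (hook_len p)%:R.
pose v0 : R := (vandermonde_exp k (fun=> 0%N))%:R; pose v1 : R := (vandermonde_exp k (nth 0%N la))%:R.
pose W : R[i] := \sum_(T : SYT la) cis t ^+ maj T.
move=> E0; have {E0} E : cis (v0 * t) * (W * (K ^+ n * (cis (H * t / 2) * (SH t)%:C))) =
  cis (v1 * t) * (K ^+ n * (cis (A * t / 2) * (SA t)%:C)) by exact: E0.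
have -> : \sum_(T : SYT la) cis (t * Y T) = W * cis (- (t * maj_center)).
  by rewrite mulr_suml; apply: eq_bigr => T _; rewrite cisX -cisD /Y; congr cis; ring.
apply: (@mulfI _ (cis (v1 * t) * (K ^+ n * cis (A * t / 2)))).
  by rewrite !mulf_neq0 ?cis_neq0 // expf_neq0.
transitivity (cis (v1 * t) * (K ^+ n * (cis (A * t / 2) * (SA t)%:C))); last by rewrite !mulrA.
rewrite -E.
have -> : cis (- (t * maj_center)) = cis (v0 * t + H * t / 2) * cis (- (v1 * t + A * t / 2)).
  by rewrite -cisD /maj_center; congr cis; rewrite -/A -/H -/v0 -/v1; field.
have e : cis (v1 * t) * cis (A * t / 2) * cis (- (v1 * t + A * t / 2)) = 1.
  by rewrite -!cisD subrr cis0.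
rewrite [cis (v0 * t + _)]cisD.
transitivity ((cis (v1 * t) * cis (A * t / 2) * cis (- (v1 * t + A * t / 2))) *
  (cis (v0 * t) * (W * (K ^+ n * (cis (H * t / 2) * (SH t)%:C))))).
  by ring.
by rewrite e mul1r.
Qed.

Let SH_gt0 t : 0 < t -> t * n%:R <= 2 -> 0 < SH t.
Proof.
move=> t0 tn; apply: prodr_gt0 => p hp; apply: sin_gt0_01; apply: arg_in01 => //.
by rewrite hook_len_gt0 //= hook_len_le.
Qed.

Lemma sum_sin_maj t : 0 < t -> t * n%:R <= 2 ->
  \sum_(T : SYT la) sin (t * ((maj T)%:R - maj_center)) = 0.
Proof.
move=> t0 tn; have := congr1 (@complex.Im R) (cis_sum t0 tn).
have -> : \sum_(T : SYT la) cis (t * Y T) =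
    (\sum_(T : SYT la) cos (t * Y T)) +i* (\sum_(T : SYT la) sin (t * Y T)).
  by apply/eqP; rewrite eq_complex /= !raddf_sum /= !eqxx.
rewrite /= mulr0 add0r => /eqP; rewrite mulf_eq0 (gt_eqF (SH_gt0 t0 tn)) orbF.
by move/eqP.
Qed.

Let sum_cos0 t : 0 < t -> t * n%:R <= 2 ->
  (\sum_(T : SYT la) cos (t * Y T)) * SH t = SA t.
Proof.
move=> t0 tn; have := congr1 (@complex.Re R) (cis_sum t0 tn).
have -> : \sum_(T : SYT la) cis (t * Y T) =
    (\sum_(T : SYT la) cos (t * Y T)) +i* (\sum_(T : SYT la) sin (t * Y T)).
  by apply/eqP; rewrite eq_complex /= !raddf_sum /= !eqxx.
by rewrite /= mulr0 subr0.
Qed.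

Definition sqdefect : R := @hook_defect R la (fun a => a%:R ^+ 2).

Lemma sqdefect_ge0 : 0 <= sqdefect.
Proof.
apply: le_trans (hook_defect_sq_ge R la).
by rewrite divr_ge0 // mulr_ge0 // sqr_ge0.
Qed.

Let G : R := (\prod_(a < n) a.+1%:R) / \prod_(p | @hook la p) (hook_len p)%:R.

Let sum_cos1 t : 0 < t -> t * n%:R <= 2 ->
  exists2 e, `|e| <= (t / 2) ^+ 4 * n%:R ^+ 2 * sqdefect &
    \sum_(T : SYT la) cos (t * Y T) = G * expR (- (t ^+ 2 * sqdefect / 24) + e).
Proof.
move=> t0 tn; pose s := t / 2; have s0 : 0 < s by rewrite divr_gt0.
pose f m := lnsinc (m%:R * s).
pose F m := f m - (m%:R * s) ^+ 2 / 6.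
have sinE m : (0 < m <= n)%N -> sin (m%:R * t / 2) = expR (F m) * s * m%:R.
  move=> mn; have /andP[ms0 ms1] := arg_in01 t0 tn mn.
  have ms : m%:R * s = m%:R * t / 2 by rewrite /s mulrA.
  rewrite /F /f /lnsinc addrK ms lnK; last first.
    by rewrite posrE divr_gt0 // sin_gt0_01 // ms0.
  by rewrite -[RHS]mulrA [s * _]mulrC ms divfK // gt_eqF.
have SAE : SA t = expR (\sum_(a < n) F a.+1) * s ^+ n * \prod_(a < n) a.+1%:R.
  rewrite /SA (eq_bigr (fun a : 'I_n => expR (F a.+1) * s * a.+1%:R)) => [|a _]; last by apply: sinE; rewrite ltn_ord.
  by rewrite 2!big_split /= prodr_const card_ord prod_expR.
have SHE : SH t = expR (\sum_(p | @hook la p) F (hook_len p)) * s ^+ n *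
    \prod_(p | @hook la p) (hook_len p)%:R.
  rewrite /SH (eq_bigr (fun p => expR (F (hook_len p)) * s * (hook_len p)%:R)) => [|p hp]; last first.
    by apply: sinE; rewrite hook_len_gt0 //= hook_len_le.
  by rewrite 2!big_split /= prodr_const prod_expR -/(hook) card_hooks.
have PH0 : \prod_(p | @hook la p) (hook_len p)%:R != 0 :> R.
  by apply/prodf_neq0 => p hp; rewrite pnatr_eq0 -lt0n hook_len_gt0.
(* The increments of [f] are at most [s^4 (m+1)^3], and those of [g] are [s^4 n^2 (2m+1)], which is
   larger since [m < n]. *)
exists (@hook_defect R la f).
  pose g m : R := s ^+ 4 * n%:R ^+ 2 * m%:R ^+ 2.
  have -> : s ^+ 4 * n%:R ^+ 2 * sqdefect = @hook_defect R la g.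
    by rewrite /sqdefect /hook_defect mulrBr !mulr_sumr.
  apply: hook_defect_le => m /andP[m0 mn].
  have /andP[ms0 _] : 0 < m%:R * s <= 1 by rewrite /s mulrA arg_in01 // m0 ltnW.
  have /andP[_ ms1] : 0 < m.+1%:R * s <= 1 by rewrite /s mulrA arg_in01.
  apply: (le_trans (lnsinc_diff ms0 _ ms1)).
    by rewrite ler_pM2r // ler_nat.
  have -> : m.+1%:R = m%:R + 1 :> R by rewrite -natr1.
  have -> : ((m%:R + 1) * s - m%:R * s) * ((m%:R + 1) * s) ^+ 3 =
     s ^+ 4 * ((m%:R + 1) ^+ 2 * (m%:R + 1)) by ring.
  have -> : g (m.+1) - g m = s ^+ 4 * (n%:R ^+ 2 * (2 * m%:R + 1)).
    by rewrite /g -natr1; ring.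
  rewrite ler_pM2l ?exprn_gt0 // ler_pM ?exprn_ge0 ?addr_ge0 //.
    by rewrite lerXn2r ?nnegrE ?addr_ge0 // natr1 ler_nat.
  by rewrite lerD2r ler_peMl // ler1n.
apply: (mulIf (lt0r_neq0 (SH_gt0 t0 tn))); rewrite sum_cos0 // SAE SHE /G.
have -> : expR (\sum_(a < n) F a.+1) = expR (- (t ^+ 2 * sqdefect / 24) + @hook_defect R la f) *
    expR (\sum_(p | @hook la p) F (hook_len p)).
  rewrite -expRD; congr expR; rewrite /sqdefect /hook_defect /F !sumrB.
  have sq (I : finType) (P : pred I) (h : I -> nat) :
      \sum_(i | P i) ((h i)%:R * s) ^+ 2 / 6 = t ^+ 2 / 24 * \sum_(i | P i) (h i)%:R ^+ 2.
    by rewrite mulr_sumr; apply: eq_bigr => i _; rewrite /s; field.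
  by rewrite (sq _ _ (fun a : 'I_n => a.+1)) (sq _ _ (@hook_len n)) -/n; ring.
by field.
Qed.

Let v_bound t e : 0 < t -> t * n%:R <= 2 ->
  `|e| <= (t / 2) ^+ 4 * n%:R ^+ 2 * sqdefect ->
  `|- (t ^+ 2 * sqdefect / 24) + e| <= t ^+ 2 * sqdefect / 3.
Proof.
move=> t0 tn eb; have S0 := sqdefect_ge0; have t2 : 0 <= t ^+ 2 := sqr_ge0 t.
apply: (le_trans (ler_normD _ _)); rewrite normrN ger0_norm; last first.
  by rewrite divr_ge0 // mulr_ge0.
have tn2 : (t * n%:R) ^+ 2 <= 2 ^+ 2.
  by rewrite lerXn2r ?nnegrE // mulr_ge0 // ltW.
have : (t / 2) ^+ 4 * n%:R ^+ 2 * sqdefect <= t ^+ 2 * sqdefect / 4.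
  have -> : (t / 2) ^+ 4 * n%:R ^+ 2 * sqdefect = t ^+ 2 * sqdefect / 16 * (t * n%:R) ^+ 2 by field.
  have -> : t ^+ 2 * sqdefect / 4 = t ^+ 2 * sqdefect / 16 * 2 ^+ 2 by field.
  by rewrite ler_wpM2l // divr_ge0 // mulr_ge0.
have := mulr_ge0 t2 S0; lra.
Qed.

Let d : R := Num.min (n.+1%:R^-1) (sqdefect + 1)^-1.

Let d_gt0 : 0 < d.
Proof. by rewrite lt_min !invr_gt0 ltr0n /= ltr_wpDl // sqdefect_ge0. Qed.

Let small t : 0 < t -> t <= d -> [/\ t <= 1, t * n%:R <= 2 & t ^+ 2 * sqdefect / 3 <= 1 / 2].
Proof.
move=> t0; rewrite le_min => /andP[tn tS]; have S0 := sqdefect_ge0.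
have t1 : t <= 1 by apply: le_trans tn _; rewrite invf_le1 ?ltr0n // ler1n.
split=> //.
  have : t * n.+1%:R <= 1 by rewrite -ler_pdivlMr ?ltr0n // div1r.
  by rewrite -natr1 mulrDr mulr1; lra.
have S1 : 0 < sqdefect + 1 by rewrite ltr_wpDl.
have : t * (sqdefect + 1) <= 1 by rewrite -ler_pdivlMr // div1r.
have : t ^+ 2 * sqdefect <= t * sqdefect.
  by rewrite ler_wpM2r // expr2 ler_piMl // ltW.
lra.
Qed.

(** The hook length formula: both sides of [sum_cos1] are compared as [t] tends to 0. *)
Let G_card : G = N%:R.
Proof.
apply/eqP; rewrite -subr_eq0; apply/eqP.
apply: (le_small_eq0 (C := \sum_(T : SYT la) Y T ^+ 2 / 2 + `|G| * sqdefect) d_gt0) => t t0 td.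
have [t1 tn tS] := small t0 td; have [e eb E] := sum_cos1 t0 tn.
have vb := v_bound t0 tn eb; set v := _ + e in E vb.
have S0 := sqdefect_ge0.
have t2 : t ^+ 2 <= t by rewrite expr2 ler_piMl // ltW.
have -> : G - N%:R = (\sum_(T : SYT la) (cos (t * Y T) - 1)) - G * (expR v - 1).
  by rewrite sumrB E sumr_const -/N; ring.
apply: (le_trans (ler_normB _ _)); rewrite mulrDl; apply: lerD.
  apply: (le_trans (ler_norm_sum _ _ _)); rewrite mulr_suml; apply: ler_sum => T _.
  apply: (le_trans (cos_bound2 _)).
  have -> : (t * Y T) ^+ 2 / 2 = t ^+ 2 * (Y T ^+ 2 / 2) by field.
  rewrite [leRHS]mulrC; apply: ler_wpM2r => //.
  by rewrite divr_ge0 // sqr_ge0.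
rewrite normrM -mulrA ler_wpM2l //.
have v12 : `|v| <= 1 / 2 by apply: le_trans vb tS.
have := expR_bound v12; have : `|expR v - 1| <= `|expR v - 1 - v| + `|v|.
  by rewrite -{1}[expR v - 1](subrK v) ler_normD.
have v2 : 2 * v ^+ 2 <= `|v|.
  rewrite -real_normK ?num_real // expr2 mulrA ler_piMl //; lra.
have : t ^+ 2 * sqdefect <= sqdefect * t by rewrite mulrC ler_wpM2l.
have := normr_ge0 v; lra.
Qed.

Lemma sum_cos_maj t : 0 < t -> t * n%:R <= 2 ->
  exists2 e, `|e| <= (t / 2) ^+ 4 * n%:R ^+ 2 * sqdefect &
    \sum_(T : SYT la) cos (t * ((maj T)%:R - maj_center)) =
    N%:R * expR (- (t ^+ 2 * sqdefect / 24) + e).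
Proof. by rewrite -G_card; exact: sum_cos1. Qed.

(** The sum of the [sin (t Y)] vanishes, and it differs from [t] times this sum by [O(t^3)]. *)
Lemma sum_maj : \sum_(T : SYT la) ((maj T)%:R - maj_center) = 0.
Proof.
apply: (le_small_eq0 (C := \sum_(T : SYT la) `|Y T| ^+ 3 / 6) d_gt0) => t t0 td.
have [t1 tn _] := small t0 td.
rewrite -(ler_pM2l t0) -{1}[t]gtr0_norm // -normrM mulr_sumr.
rewrite (_ : \sum_(T : SYT la) _ = \sum_(T : SYT la) (t * Y T - sin (t * Y T))); last first.
  by rewrite sumrB sum_sin_maj // subr0.
apply: (le_trans (ler_norm_sum _ _ _)); rewrite mulr_suml mulr_sumr; apply: ler_sum => T _.
rewrite distrC; apply: (le_trans (sin_bound _)).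
rewrite normrM gtr0_norm // exprMn -/(Y T).
have -> : t * (`|Y T| ^+ 3 / 6 * t) = t ^+ 2 * `|Y T| ^+ 3 / 6 by ring.
rewrite ler_pM2r ?invr_gt0 ?ltr0n // ler_wpM2r ?exprn_ge0 //.
by rewrite exprSr ler_piMr // sqr_ge0.
Qed.

(** Comparison of the coefficients of [t^2] in [sum_cos_maj]; [key] bounds the remainder by a
    multiple of [t^4]. *)
Lemma sum_sq_maj : \sum_(T : SYT la) ((maj T)%:R - maj_center) ^+ 2 = N%:R * (sqdefect / 12).
Proof.
apply/eqP; rewrite -subr_eq0; apply/eqP.
apply: (le_small_eq0 (C := \sum_(T : SYT la) Y T ^+ 4 + N%:R * (2 * (n%:R ^+ 2 * sqdefect + 2 * sqdefect ^+ 2))) d_gt0) => t t0 td.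
have [t1 tn tS] := small t0 td; have [e eb E] := sum_cos_maj t0 tn.
have vb := v_bound t0 tn eb; set v := _ + e in E vb.
have S0 := sqdefect_ge0; have t2 : 0 < t ^+ 2 by rewrite exprn_gt0.
have v12 : `|v| <= 1 / 2 by apply: le_trans vb tS.
set Q := \sum_(T : SYT la) Y T ^+ 4.
have key : `|t ^+ 2 * (\sum_(T : SYT la) Y T ^+ 2 - N%:R * (sqdefect / 12))| <=
    t ^+ 4 * (Q + N%:R * (2 * (n%:R ^+ 2 * sqdefect + 2 * sqdefect ^+ 2))).
  have -> : t ^+ 2 * (\sum_(T : SYT la) Y T ^+ 2 - N%:R * (sqdefect / 12)) =
    2 * \sum_(T : SYT la) (cos (t * Y T) - 1 + (t * Y T) ^+ 2 / 2) -
    N%:R * (2 * (expR v - 1 - v) + 2 * e).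
    rewrite big_split sumrB /= E sumr_const -/N.
    have -> : \sum_(T : SYT la) (t * Y T) ^+ 2 / 2 = t ^+ 2 / 2 * \sum_(T : SYT la) Y T ^+ 2.
      by rewrite mulr_sumr; apply: eq_bigr => T _; field.
    by rewrite /v; field.
  apply: (le_trans (ler_normB _ _)); rewrite [t ^+ 4 * _]mulrDr; apply: lerD.
    rewrite normrM gtr0_norm // /Q !mulr_sumr -[X in _ <= X]mulr_sumr.
    apply: (@le_trans _ _ (2 * \sum_(T : SYT la) (t * Y T) ^+ 4 / 24)).
      rewrite ler_pM2l // (le_trans (ler_norm_sum _ _ _)) // ler_sum // => T _.
      exact: cos_bound.
    rewrite -mulr_suml mulr_sumr; rewrite (eq_bigr (fun T => t ^+ 4 * Y T ^+ 4)) => [|T _]; last by rewrite exprMn.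
    rewrite -mulr_sumr -/Q.
    have : 0 <= t ^+ 4 * Q by rewrite mulr_ge0 ?exprn_ge0 ?(ltW t0) // sumr_ge0 // => T _; rewrite (exprM _ 2 2) sqr_ge0.
    lra.
  rewrite normrM ger0_norm // mulrCA ler_wpM2l //.
  apply: (le_trans (ler_normD _ _)); rewrite !normrM !normr_nat.
  rewrite mulrCA -mulrDr ler_pM2l // [t ^+ 4 * _]mulrDr addrC; apply: lerD.
    apply: (le_trans eb).
    have -> : (t / 2) ^+ 4 * n%:R ^+ 2 * sqdefect = t ^+ 4 * (n%:R ^+ 2 * sqdefect) / 16 by field.
    have : 0 <= t ^+ 4 * (n%:R ^+ 2 * sqdefect).
      by rewrite mulr_ge0 ?exprn_ge0 ?(ltW t0) // mulr_ge0 // sqr_ge0.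
    lra.
  apply: (le_trans (expR_bound v12)).
  have : v ^+ 2 <= (t ^+ 2 * sqdefect / 3) ^+ 2.
    by rewrite -real_normK ?num_real // lerXn2r ?nnegrE ?divr_ge0 ?mulr_ge0 // ltW.
  have -> : (t ^+ 2 * sqdefect / 3) ^+ 2 = t ^+ 4 * sqdefect ^+ 2 / 9 by field.
  have : 0 <= t ^+ 4 * sqdefect ^+ 2 by rewrite mulr_ge0 ?exprn_ge0 // ltW.
  lra.
rewrite -(ler_pM2l t2) -{1}[t ^+ 2]gtr0_norm // -normrM; apply: le_trans key _.
have -> : t ^+ 4 = t ^+ 2 * (t * t) by ring.
rewrite -mulrA ler_pM2l // mulrC ler_wpM2l //; last by rewrite ler_piMl // ltW.
rewrite addr_ge0 ?sumr_ge0 ?mulr_ge0 ?addr_ge0 ?mulr_ge0 ?sqr_ge0 // => T _.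
by rewrite (exprM _ 2 2) sqr_ge0.
Qed.

End maj_characteristic_function.

(** * A continuity theorem *)

Section levy_continuity.
Local Open Scope ring_scope.
Local Open Scope classical_set_scope.
Variable R : realType.
Implicit Types (f g w : R -> R).

Definition bounded_measurable f :=
  measurable_fun [set: R] f /\ exists M, forall x, `|f x| <= M.

(** What the average over tableaux and the normal integral have in common; the continuity theorem
    uses nothing else about them. *)
Record is_mean (E : (R -> R) -> R) : Prop := IsMean {
  meanD : forall f g, bounded_measurable f -> bounded_measurable g ->
    E (fun x => f x + g x) = E f + E g;
  meanZ : forall c f, bounded_measurable f -> E (fun x => c * f x) = c * E f;
  mean_le : forall f g, bounded_measurable f -> bounded_measurable g ->
    (forall x, f x <= g x) -> E f <= E g;
  mean1 : E (fun=> 1) = 1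
}.

Lemma bounded_measurable_cst c : bounded_measurable (fun=> c).
Proof. by split; [exact: measurable_cst | exists `|c|]. Qed.

Lemma bounded_measurableD f g : bounded_measurable f -> bounded_measurable g ->
  bounded_measurable (fun x => f x + g x).
Proof.
move=> [mf [Mf fM]] [mg [Mg gM]]; split; first exact: measurable_funD.
by exists (Mf + Mg) => x; rewrite (le_trans (ler_normD _ _)) // lerD.
Qed.

Lemma bounded_measurableM f g : bounded_measurable f -> bounded_measurable g ->
  bounded_measurable (fun x => f x * g x).
Proof.
move=> [mf [Mf fM]] [mg [Mg gM]]; split; first exact: measurable_funM.
by exists (Mf * Mg) => x; rewrite normrM ler_pM.
Qed.

Lemma bounded_measurable_cos a b : bounded_measurable (fun x => cos (a * x + b)).
Proof.
split; last by exists 1 => x; exact: cos_max.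
apply: (measurableT_comp (f := cos)).
  by apply: continuous_measurable_fun; exact: continuous_cos.
by apply: measurable_funD => //; exact: measurable_funM.
Qed.

Lemma bounded_measurable_indic (A : set R) : measurable A ->
  bounded_measurable \1_A.
Proof.
move=> mA; split; first exact: measurable_indic.
by exists 1 => x; rewrite indicE normr_nat lern1 leq_b1.
Qed.

Lemma measurable_tail M : measurable [set x : R | M < `|x|].
Proof.
rewrite (_ : [set x | M < `|x|] = ~` `[- M, M]); first by apply: measurableC; exact: measurable_itv.
apply/seteqP; split=> x; rewrite /= in_itv /= -ler_norml; first by rewrite ltNge => /negP.
by move=> /negP; rewrite -ltNge.
Qed.

Lemma bounded_tail M : bounded_measurable \1_[set x : R | M < `|x|].
Proof. by apply: bounded_measurable_indic; exact: measurable_tail. Qed.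

Section convergence.
Variables (Es : nat -> (R -> R) -> R) (E : (R -> R) -> R).
Hypotheses (Esm : forall n, is_mean (Es n)) (Em : is_mean E).
Hypothesis cvg_cos : forall a b,
  Es n (fun x => cos (a * x + b)) @[n --> \oo] --> E (fun x => cos (a * x + b)).

(* The functions [w] below form an algebra that contains every [x |-> cos (a x + b)], because products of cosines are sums of cosines. *)
Let stable f := bounded_measurable f /\
  forall a b, Es n (fun x => f x * cos (a * x + b)) @[n --> \oo] -->
    E (fun x => f x * cos (a * x + b)).

Let multiplier w := bounded_measurable w /\
  forall f, stable f -> stable (fun x => f x * w x).

Let funE (T : Type) (F : (R -> R) -> T) f g : (forall x, f x = g x) -> F f = F g.
Proof. by move=> fg; congr F; apply/funext. Qed.

Let stableD f g : stable f -> stable g -> stable (fun x => f x + g x).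
Proof.
move=> [bf sf] [bg sg]; split=> [|a b]; first exact: bounded_measurableD.
have bc := bounded_measurable_cos a b.
have split_mean F : is_mean F -> F (fun x => (f x + g x) * cos (a * x + b)) =
    F (fun x => f x * cos (a * x + b)) + F (fun x => g x * cos (a * x + b)).
  move=> Fm; rewrite -(meanD Fm); try exact: bounded_measurableM.
  by apply: funE => x; rewrite mulrDl.
rewrite split_mean // (_ : (fun n => Es n _) = (fun n => Es n (fun x => f x * cos (a * x + b)) +
  Es n (fun x => g x * cos (a * x + b)))); last by apply/funext => n; exact: split_mean.
by apply: cvgD; [exact: sf | exact: sg].
Qed.

Let stableZ c f : stable f -> stable (fun x => c * f x).
Proof.
move=> [bf sf]; split=> [|a b].
  by apply: bounded_measurableM => //; exact: bounded_measurable_cst.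
have bc := bounded_measurable_cos a b.
have split_mean F : is_mean F -> F (fun x => c * f x * cos (a * x + b)) =
    c * F (fun x => f x * cos (a * x + b)).
  move=> Fm; rewrite -(meanZ Fm); try exact: bounded_measurableM.
  by apply: funE => x; rewrite mulrA.
rewrite split_mean // (_ : (fun n => Es n _) = (fun n => c * Es n (fun x => f x * cos (a * x + b)))); last first.
  by apply/funext => n; exact: split_mean.
by apply: cvgM; [exact: cvg_cst | exact: sf].
Qed.

Let stable_cos c d f : stable f -> stable (fun x => f x * cos (c * x + d)).
Proof.
move=> [bf sf]; split=> [|a b].
  by apply: bounded_measurableM => //; exact: bounded_measurable_cos.
have E2 x : f x * cos (c * x + d) * cos (a * x + b) =
    2^-1 * f x * cos ((c + a) * x + (d + b)) + 2^-1 * f x * cos ((c - a) * x + (d - b)).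
  have -> : (c + a) * x + (d + b) = (c * x + d) + (a * x + b) by ring.
  have -> : (c - a) * x + (d - b) = (c * x + d) - (a * x + b) by ring.
  by set p := c * x + d; set r := a * x + b; rewrite (cosD p r) (cosB p r); field.
have sf2 : stable (fun x => 2^-1 * f x) by apply: stableZ.
have bc1 := bounded_measurable_cos (c + a) (d + b).
have bc2 := bounded_measurable_cos (c - a) (d - b).
have split_mean F : is_mean F -> F (fun x => f x * cos (c * x + d) * cos (a * x + b)) =
  F (fun x => 2^-1 * f x * cos ((c + a) * x + (d + b))) + F (fun x => 2^-1 * f x * cos ((c - a) * x + (d - b))).
  move=> Fm; rewrite (funE F E2) (meanD Fm) //; apply: bounded_measurableM => //; exact: sf2.1.
rewrite split_mean // (_ : (fun n => Es n _) = (fun n => Es n (fun x => 2^-1 * f x * cos ((c + a) * x + (d + b))) +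
   Es n (fun x => 2^-1 * f x * cos ((c - a) * x + (d - b))))); last first.
  by apply/funext => n; exact: split_mean.
by apply: cvgD; exact: sf2.2.
Qed.

Let multiplier_cst c : multiplier (fun=> c).
Proof.
split=> [|f sf]; first exact: bounded_measurable_cst.
by rewrite (funE stable (fun x => mulrC (f x) c)); exact: stableZ.
Qed.

Let multiplier_cos a b : multiplier (fun x => cos (a * x + b)).
Proof. by split=> [|f sf]; [exact: bounded_measurable_cos | exact: stable_cos]. Qed.

Let multiplierD v w : multiplier v -> multiplier w -> multiplier (fun x => v x + w x).
Proof.
move=> [bv mv] [bw mw]; split=> [|f sf]; first exact: bounded_measurableD.
rewrite (funE stable (fun x => mulrDr (f x) (v x) (w x))).
by apply: stableD; [exact: mv | exact: mw].
Qed.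

Let multiplierM v w : multiplier v -> multiplier w -> multiplier (fun x => v x * w x).
Proof.
move=> [bv mv] [bw mw]; split=> [|f sf]; first exact: bounded_measurableM.
by rewrite (funE stable (fun x => mulrA (f x) (v x) (w x))); exact/mw/mv.
Qed.

Let multiplierX w m : multiplier w -> multiplier (fun x => w x ^+ m).
Proof.
move=> mw; elim: m => [|m IH].
  by rewrite (funE multiplier (fun x => expr0 (w x))); exact: multiplier_cst.
by rewrite (funE multiplier (fun x => exprS (w x) m)); exact: multiplierM.
Qed.

Let multiplier_cvg w : multiplier w -> Es n w @[n --> \oo] --> E w.
Proof.
move=> [bw mw].
have s1 : stable (fun=> 1).
  split=> [|a b]; first exact: bounded_measurable_cst.
  rewrite (funE E (fun x => mul1r (cos (a * x + b)))).
  by rewrite (_ : (fun n => Es n _) = (fun n => Es n (fun x => cos (a * x + b)))) //;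
    apply/funext => n; apply: funE => x; rewrite mul1r.
have [_ /(_ 0 0)] := mw _ s1.
have e x : 1 * w x * cos (0 * x + 0) = w x by rewrite mul0r addr0 cos0 mulr1 mul1r.
rewrite (funE E e) (_ : (fun n => Es n _) = Es ^~ w) //.
by apply/funext => n; exact: funE.
Qed.

(* Bernoulli's inequality gives [(1 - u ^ m) ^ (2 ^ m) >= 1 - (2 u) ^ m] as well as [(1 - u ^ m) ^ (2 ^ m) <= 1 / (2 u) ^ m]. *)
Lemma step_polynomial (k eta : R) : 0 < k -> k <= 1 -> 0 < eta ->
  exists m : nat, forall u : R, 0 <= u -> u <= 1 ->
  [/\ 0 <= (1 - u ^+ m) ^+ (2 ^ m) <= 1,
      u <= (1 - k) / 2 -> 1 - eta <= (1 - u ^+ m) ^+ (2 ^ m) &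
      (1 + k) / 2 <= u -> (1 - u ^+ m) ^+ (2 ^ m) <= eta].
Proof.
move=> k0 k1 eta0.
have bern (y : R) N : - 1 <= y -> 1 + N%:R * y <= (1 + y) ^+ N.
  move=> y1; elim: N => [|N IH]; first by rewrite mul0r addr0 expr0.
  rewrite exprS; apply: le_trans (ler_wpM2l _ IH); last by lra.
  rewrite -natr1; have := mulr_ge0 (ler0n R N) (sqr_ge0 y); nra.
(* With this [m], Bernoulli gives [(1 + k)^m >= 1 + m k >= 1 / eta]. *)
have [m mk] : exists m : nat, (eta * k)^-1 <= m%:R.
  by exists (Num.bound (eta * k)^-1); rewrite ltW // archi_boundP // invr_ge0 mulr_ge0 ?ltW.
have ek : 1 <= m%:R * k * eta.
  by move: mk; rewrite -[_^-1]div1r ler_pdivrMr ?mulr_gt0 // -mulrA [k * _]mulrC.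
have big : eta^-1 <= (1 + k) ^+ m.
  apply: le_trans (bern k m _); last by lra.
  by rewrite -[X in X <= _]mul1r ler_pdivrMr //; nra.
exists m => u u0 u1; have um0 : 0 <= u ^+ m by rewrite exprn_ge0.
have um1 : u ^+ m <= 1 by rewrite exprn_ile1.
have w01 : 0 <= (1 - u ^+ m) ^+ (2 ^ m) <= 1.
  by rewrite exprn_ge0 ?exprn_ile1 ?subr_ge0 //; lra.
split=> // uk.
  apply: le_trans (bern _ _ _); last by lra.
  rewrite mulrN lerD2l lerN2 natrX -exprMn.
  apply: (@le_trans _ _ ((1 - k) ^+ m)).
    by rewrite lerXn2r // ?nnegrE; lra.
  have h : (1 - k) ^+ m * (1 + k) ^+ m <= 1.
    by rewrite -exprMn exprn_ile1 //; nra.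
  have k2 : 0 <= (1 - k) ^+ m by rewrite exprn_ge0 //; lra.
  have : (1 - k) ^+ m * eta^-1 <= 1 by apply: le_trans h; rewrite ler_wpM2l.
  by rewrite ler_pdivrMr // mul1r.
have h : (1 - u ^+ m) ^+ (2 ^ m) * (1 + u ^+ m) ^+ (2 ^ m) <= 1.
  by rewrite -exprMn exprn_ile1 //; nra.
have h2 : eta^-1 <= (1 + u ^+ m) ^+ (2 ^ m).
  apply: (le_trans big); apply: le_trans (bern _ _ _); last by lra.
  rewrite natrX -exprMn -[X in X <= _]add0r lerD //.
  by rewrite lerXn2r // ?nnegrE; lra.
have w0 : 0 <= (1 - u ^+ m) ^+ (2 ^ m) by case/andP: w01.
have : (1 - u ^+ m) ^+ (2 ^ m) * eta^-1 <= 1 by apply: le_trans h; rewrite ler_wpM2l.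
by rewrite ler_pdivrMr // mul1r.
Qed.

(** The step polynomial is applied to [u = (1 + sin ((x - s) / L)) / 2]. The scale [L] keeps
    [(x - s) / L] within [-1, 1] when [|x| <= M], where the sine increases; elsewhere only the
    bounds 0 and 1 survive. *)
Let step_multiplier (s de M eta : R) : 0 < de -> 0 <= M -> 0 < eta ->
  exists w, [/\ multiplier w, (forall x, 0 <= w x <= 1),
    (forall x, `|x| <= M -> x <= s - de -> 1 - eta <= w x) &
    (forall x, `|x| <= M -> s + de <= x -> w x <= eta)].
Proof.
move=> de0 M0 eta0; pose L := M + `|s| + de + 1.
have s0 := normr_ge0 s.
have L0 : 0 < L by rewrite /L; lra.
have pi2 := @pi_ge2 R.
have dL0 : 0 < de / L by rewrite divr_gt0.
have dL1 : de / L <= 1 by rewrite ler_pdivrMr // mul1r /L; lra.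
pose k := sin (de / L).
have k0 : 0 < k by apply: sin_gt0_pi; rewrite dL0 /=; lra.
have [m mP] := step_polynomial k0 (sin_le1 _) eta0.
pose u x := 2^-1 * (1 + sin ((x - s) / L)).
have u01 x : 0 <= u x <= 1.
  by have := sin_geN1 ((x - s) / L); have := sin_le1 ((x - s) / L); rewrite /u; lra.
have uM x : `|x| <= M -> `|(x - s) / L| <= 1.
  move=> xM; rewrite normrM [`|_^-1|]gtr0_norm ?invr_gt0 // ler_pdivrMr // mul1r.
  by rewrite (le_trans (ler_normB _ _)) // /L; lra.
exists (fun x => (1 + (-1) * u x ^+ m) ^+ (2 ^ m)); split.
- apply: multiplierX; apply: multiplierD; first exact: multiplier_cst.
  apply: multiplierM; first exact: multiplier_cst.
  apply: multiplierX; apply: multiplierM; first exact: multiplier_cst.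
  apply: multiplierD; first exact: multiplier_cst.
  have e x : sin ((x - s) / L) = cos (L^-1 * x + (- (s / L) - pi / 2)).
    by rewrite addrA cosBpihalf; congr sin; ring.
  by rewrite (funE multiplier e); exact: multiplier_cos.
- by move=> x; rewrite mulN1r; have /andP[u0 u1] := u01 x; have [] := mP _ u0 u1.
- move=> x xM xs; rewrite mulN1r; have /andP[u0 u1] := u01 x; have [_ + _] := mP _ u0 u1.
  apply; have /andP[x1 x2] : - 1 <= (x - s) / L <= 1 by rewrite -ler_norml uM.
  suff : sin ((x - s) / L) <= sin (- (de / L)) by rewrite sinN -/k /u; lra.
  have xd : (x - s) / L <= - (de / L) by rewrite -mulNr ler_pM2r ?invr_gt0 //; lra.
  by rewrite leNgt ltr_sin ?in_itv /= -?leNgt //; apply/andP; split; lra.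
- move=> x xM xs; rewrite mulN1r; have /andP[u0 u1] := u01 x; have [_ _ +] := mP _ u0 u1.
  apply; have /andP[x1 x2] : - 1 <= (x - s) / L <= 1 by rewrite -ler_norml uM.
  suff : k <= sin ((x - s) / L) by rewrite /u; lra.
  have xd : de / L <= (x - s) / L by rewrite ler_pM2r ?invr_gt0 //; lra.
  by rewrite leNgt ltr_sin ?in_itv /= -?leNgt //; apply/andP; split; lra.
Qed.

Let tail M : set R := [set x | M < `|x|].

Let step t : R -> R := \1_(`]-oo, t]%classic).

Let stepE t x : step t x = (x <= t)%R%:R.
Proof. by rewrite /step indicE mem_setE in_itv. Qed.

Let bounded_step t : bounded_measurable (step t).
Proof. by apply: bounded_measurable_indic; exact: measurable_itv. Qed.

Let tailE M x : (\1_(tail M) x : R) = (M < `|x|)%R%:R.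
Proof. by rewrite indicE (_ : (x \in tail M) = (M < `|x|)%R) //; apply/idP/idP; rewrite inE. Qed.

Let mean_cst F : is_mean F -> forall c, F (fun=> c) = c.
Proof.
move=> Fm c; rewrite -[RHS]mulr1 -(mean1 Fm) -(meanZ Fm); last exact: bounded_measurable_cst.
by apply: funE => x; rewrite mulr1.
Qed.

Let mean_add3 F f c g : is_mean F -> bounded_measurable f -> bounded_measurable g ->
  F (fun x => f x + (c + g x)) = F f + (c + F g).
Proof.
move=> Fm bf bg; have bc := bounded_measurable_cst c.
have bcg := bounded_measurableD bc bg.
by rewrite (meanD Fm bf bcg) (meanD Fm bc bg) mean_cst.
Qed.

Let mean_step_le F w t M eta : is_mean F -> bounded_measurable w -> 0 <= eta ->
  (forall x, 0 <= w x <= 1) -> (forall x, `|x| <= M -> t <= x -> w x <= eta) ->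
  F w <= F (step t) + (eta + F \1_(tail M)).
Proof.
move=> Fm bw eta0 w01 wt; rewrite -mean_add3 //; try exact: bounded_tail.
apply: (mean_le Fm) => // [|x].
  apply: bounded_measurableD => //; apply: bounded_measurableD; last exact: bounded_tail.
  exact: bounded_measurable_cst.
rewrite stepE tailE; have /andP[w0 w1] := w01 x; have := wt x.
by case: (leP x t) => xt; case: (leP `|x| M) => xM /= wtx; lra.
Qed.

Let mean_step_ge F w t M eta : is_mean F -> bounded_measurable w -> 0 <= eta ->
  (forall x, 0 <= w x <= 1) -> (forall x, `|x| <= M -> x <= t -> 1 - eta <= w x) ->
  F (step t) <= F w + (eta + F \1_(tail M)).
Proof.
move=> Fm bw eta0 w01 wt; rewrite -mean_add3 //; try exact: bounded_tail.
apply: (mean_le Fm) => // [|x].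
  apply: bounded_measurableD => //; apply: bounded_measurableD; last exact: bounded_tail.
  exact: bounded_measurable_cst.
rewrite stepE tailE; have /andP[w0 w1] := w01 x; have := wt x.
by case: (leP x t) => xt; case: (leP `|x| M) => xM /= wtx; lra.
Qed.

Lemma cvg_mean_step t :
  (forall e, 0 < e -> exists2 M, 0 <= M & E \1_[set x | M < `|x|] <= e /\
     forall n, Es n \1_[set x | M < `|x|] <= e) ->
  (forall e, 0 < e -> exists2 de, 0 < de &
     E \1_(`]-oo, (t + de)%R]) - E \1_(`]-oo, (t - de)%R]) <= e) ->
  Es n \1_(`]-oo, t]) @[n --> \oo] --> E \1_(`]-oo, t]).
Proof.
(* The functions [w] and [v] below drop from 1 to 0 over [[t, t + de]] and [[t - de, t]]. Each side
   loses [2e] twice in comparing steps with [w] or [v], [e] in the limit and [e] by continuity, so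
   [6e] in all. *)
move=> tight cont; apply/cvgrPdist_le => e0 e00; pose e := e0 / 10.
have e_gt0 : 0 < e by rewrite divr_gt0.
have [de de0 contt] := cont _ e_gt0; have [M M0 [tE tEs]] := tight _ e_gt0.
pose d := de / 2; have d0 : 0 < d by rewrite divr_gt0.
have [w [mw w01 wge wle]] := @step_multiplier (t + d) d M e d0 M0 e_gt0.
have [v [mv v01 vge vle]] := @step_multiplier (t - d) d M e d0 M0 e_gt0.
have wge' x : `|x| <= M -> x <= t -> 1 - e <= w x.
  by move=> xM xt; apply: wge => //; lra.
have wle' x : `|x| <= M -> t + de <= x -> w x <= e.
  by move=> xM xt; apply: wle => //; rewrite /d in xt *; lra.
have vge' x : `|x| <= M -> x <= t - de -> 1 - e <= v x.
  by move=> xM xt; apply: vge => //; rewrite /d in xt *; lra.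
have vle' x : `|x| <= M -> t <= x -> v x <= e.
  by move=> xM xt; apply: vle => //; lra.
have cw := multiplier_cvg mw; have cv := multiplier_cvg mv.
have Ew := mean_step_le Em mw.1 (ltW e_gt0) w01 wle'.
have Ev := mean_step_ge Em mv.1 (ltW e_gt0) v01 vge'.
have mono s s' : s <= s' -> E (step s) <= E (step s').
  move=> ss; apply: (mean_le Em) => // x; rewrite !stepE ler_nat.
  by case: (leP x s) => // /le_trans/(_ ss) ->.
have m1 : E (step (t - de)) <= E (step t) by apply: mono; lra.
have m2 : E (step t) <= E (step (t + de)) by apply: mono; lra.
near=> n.
have Esw := mean_step_ge (Esm n) mw.1 (ltW e_gt0) w01 wge'.
have Esv := mean_step_le (Esm n) mv.1 (ltW e_gt0) v01 vle'.
have tn := tEs n.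
have : `|E w - Es n w| <= e by near: n; move/cvgrPdist_le : cw; exact.
have : `|E v - Es n v| <= e by near: n; move/cvgrPdist_le : cv; exact.
rewrite !ler_norml => /andP[v1 v2] /andP[w1 w2].
move: contt tE tn Esw Esv Ew Ev m1 m2; rewrite /tail /step => *.
have ee : e0 = 10 * e by rewrite /e; field.
by rewrite ee; apply/andP; split; lra.
Unshelve. all: by end_near. Qed.

End convergence.
End levy_continuity.

(** * The standard normal distribution *)

Section standard_normal.
Local Open Scope ring_scope.
Local Open Scope classical_set_scope.
Variable R : realType.
Local Notation mu := (@lebesgue_measure R).
Implicit Types (f g : R -> R).

Let ph : R -> R := normal_pdf 0 1.
Let c : R := normal_peak 1.

Let phE x : ph x = c * expR (- (x ^+ 2 / 2)).
Proof.
rewrite /ph normal_pdfE ?oner_neq0 // /normal_fun subr0 expr1n mulNr.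
by rewrite -[1 *+ 2]/(2%:R).
Qed.

Let c_gt0 : 0 < c.
Proof. exact: normal_peak_gt0 (oner_neq0 _). Qed.

Let ph_ge0 x : 0 <= ph x.
Proof. exact: normal_pdf_ge0. Qed.

Let mph : measurable_fun [set: R] ph.
Proof. exact: measurable_normal_pdf. Qed.

Let iph : mu.-integrable [set: R] (EFin \o ph).
Proof. exact: integrable_normal_pdf. Qed.

(** The density of variance 2 decays like [exp (- x^2 / 4)], slowly enough for a multiple of it to
    dominate [|x| * ph x]. *)
Let psi : R -> R := normal_pdf 0 (Num.sqrt 2).

Let ipsi : mu.-integrable [set: R] (EFin \o psi).
Proof. exact: integrable_normal_pdf. Qed.

Let K : R := c / normal_peak (Num.sqrt 2).

Let sqrt2_neq0 : Num.sqrt 2 != 0 :> R.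
Proof. by rewrite gt_eqF // sqrtr_gt0. Qed.

Let K_ge0 : 0 <= K.
Proof. by rewrite divr_ge0 ?normal_peak_ge0. Qed.

(* [|x| <= 1 + x ^ 2 / 4 <= exp (x ^ 2 / 4)] *)
Let ph_psi x : `|x| * ph x <= K * psi x.
Proof.
rewrite phE /psi normal_pdfE // /normal_fun subr0 sqr_sqrtr // mulNr.
rewrite /K [leRHS]mulrA divfK ?gt_eqF ?normal_peak_gt0 // mulrCA ler_pM2l //.
have -> : 2 *+ 2 = 4 :> R by rewrite -mulr_natr -natrM.
have -> : - (x ^+ 2 / 2) = - (x ^+ 2 / 4) - (x ^+ 2 / 4) by field.
rewrite expRD mulrA ger_pMl ?expR_gt0 // -ler_pdivlMr ?expR_gt0 // -expRN opprK mul1r.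
apply: le_trans (expR_ge1Dx _); rewrite -[x ^+ 2]real_normK ?num_real //.
by have := sqr_ge0 (`|x| - 2); lra.
Qed.

Let integrable_ph f : bounded_measurable f ->
  mu.-integrable [set: R] (EFin \o (fun x => f x * ph x)).
Proof.
move=> [mf [M fM]].
apply: (@le_integrable _ _ _ mu _ measurableT _ (fun x => M%:E * (EFin \o ph) x)%E); last exact: integrableZl.
  by apply/measurable_EFinP; exact: measurable_funM.
move=> x _; rewrite /= lee_fin [leRHS]ger0_norm; last first.
  by rewrite mulr_ge0 // (le_trans _ (fM x)).
by rewrite normrM [`|ph x|]ger0_norm // ler_wpM2r.
Qed.

Let integrable_id_ph f : bounded_measurable f ->
  mu.-integrable [set: R] (EFin \o (fun x => x * f x * ph x)).
Proof.
move=> [mf [M fM]].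
apply: (@le_integrable _ _ _ mu _ measurableT _ (fun x => (M * K)%:E * (EFin \o psi) x)%E); last exact: integrableZl.
  by apply/measurable_EFinP; apply: measurable_funM => //; exact: measurable_funM.
move=> x _; rewrite /= lee_fin [leRHS]ger0_norm; last first.
  by rewrite mulr_ge0 ?normal_pdf_ge0 // mulr_ge0 // (le_trans _ (fM x)).
rewrite !normrM [`|ph x|]ger0_norm // mulrAC mulrC -mulrA.
by apply: ler_pM; rewrite ?mulr_ge0 // ph_psi.
Qed.

Definition normal_mean f : R := \int[mu]_x (f x * ph x).

Lemma normal_mean_is_mean : is_mean normal_mean.
Proof.
split=> [f g bf bg|a f bf|f g bf bg fg|].
- rewrite /normal_mean -RintegralD //; try exact: integrable_ph.
  by apply: eq_Rintegral => x _; rewrite mulrDl.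
- rewrite /normal_mean -RintegralZl //; last exact: integrable_ph.
  by apply: eq_Rintegral => x _; rewrite mulrA.
- apply: le_Rintegral => //; try exact: integrable_ph.
  by move=> x _; rewrite ler_wpM2r.
- rewrite /normal_mean; under eq_Rintegral do rewrite mul1r.
  by rewrite /Rintegral integral_normal_pdf.
Qed.

Lemma normal_probE (A : set R) : measurable A ->
  normal_prob 0 1 A = (normal_mean \1_A)%:E.
Proof.
move=> mA; rewrite /normal_mean /Rintegral fineK; last first.
  by apply: integrable_fin_num => //; apply: integrable_ph; exact: bounded_measurable_indic.
rewrite /normal_prob [LHS]integral_mkcond; apply: eq_integral => x _.
by rewrite patchE indicE; case: (x \in A); rewrite ?mul1r ?mul0r.
Qed.

(** Markov's inequality for [|x|], whose mean is at most [K] by [ph_psi]. *)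
Lemma normal_mean_tail e : 0 < e ->
  exists2 M, 0 < M & normal_mean \1_[set x | M < `|x|] <= e.
Proof.
move=> e0; pose M := K / e + 1; have M0 : 0 < M by rewrite ltr_wpDl // divr_ge0 // ltW.
exists M => //; apply: (@le_trans _ _ (\int[mu]_x (K / M * psi x))).
  apply: le_Rintegral => //; first exact/integrable_ph/bounded_tail.
    exact: (integrableZl measurableT (K / M) ipsi).
  move=> x _; rewrite indicE; case: (boolP (x \in _)) => [|_]; last first.
    by rewrite mul0r mulr_ge0 ?normal_pdf_ge0 // divr_ge0 // ltW.
  rewrite inE /= => Mx; rewrite mul1r mulrAC ler_pdivlMr //.
  by apply: le_trans (ph_psi x); rewrite mulrC ler_wpM2r // ltW.
rewrite RintegralZl // /Rintegral integral_normal_pdf mulr1 ler_pdivrMr //.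
by rewrite /M mulrDr mulr1 mulrCA divff ?gt_eqF // mulr1 lerDl ltW.
Qed.

Let normal_mean_itv a b : a <= b ->
  normal_mean \1_(`]a, b]) = \int[mu]_(x in `]a, b]) ph x.
Proof.
move=> ab; rewrite /normal_mean [RHS]Rintegral_mkcond; apply: eq_Rintegral => x _.
by rewrite patchE indicE; case: (x \in _); rewrite ?mul1r ?mul0r.
Qed.

Let iph_itv a b : mu.-integrable `]a, b] (EFin \o ph).
Proof. by apply: (integrableS _ _ (@subsetT _ _) iph) => //; exact: measurable_itv. Qed.

Let icst_itv a b r : mu.-integrable `]a, b] (EFin \o (fun=> r : R)).
Proof.
apply: measurable_bounded_integrable => //.
  by rewrite /= lebesgue_measure_itv; case: ifP => //= _; rewrite -EFinB ltry.
exists `|r|; split; first exact: num_real.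
by move=> y ry z _ /=; exact: ltW.
Qed.

Let mu_itv a b : a <= b -> fine (mu `]a, b]) = b - a.
Proof.
move=> ab; rewrite lebesgue_measure_itv /= lte_fin; case: ltP => // ba.
by have -> : a = b; [apply/eqP; rewrite eq_le ab | rewrite subrr].
Qed.

Lemma normal_mean_cont t d : 0 < d ->
  normal_mean \1_(`]-oo, (t + d)%R]) - normal_mean \1_(`]-oo, (t - d)%R]) <= c * (2 * d).
Proof.
move=> d0; have Em := normal_mean_is_mean.
have ab : t - d <= t + d by lra.
have -> : normal_mean \1_(`]-oo, (t + d)%R]) =
    normal_mean \1_(`]-oo, (t - d)%R]) + normal_mean \1_(`](t - d)%R, (t + d)%R]).
  rewrite -(meanD Em); try by apply: bounded_measurable_indic; exact: measurable_itv.
  congr normal_mean; apply/funext => x; rewrite !indicE !mem_setE !in_itv /=.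
  by rewrite -natrD; congr (_%:R); case: (leP x (t - d)) => xt; case: (leP x (t + d)) => // xtd; exfalso; lra.
rewrite addrC addKr normal_mean_itv //.
have -> : c * (2 * d) = \int[mu]_(x in `](t - d)%R, (t + d)%R]) c.
  by rewrite Rintegral_cst // mu_itv //; congr (_ * _); ring.
apply: le_Rintegral => // x _.
by apply: normal_pdf_ub; exact: oner_neq0.
Qed.

Lemma normal_mean_gt0 t : 0 < normal_mean \1_(`]-oo, t]).
Proof.
have Em := normal_mean_is_mean; pose m0 := c * expR (- ((`|t| + 1) ^+ 2 / 2)).
have m00 : 0 < m0 by rewrite mulr_gt0 ?expR_gt0.
apply: (@lt_le_trans _ _ (normal_mean \1_(`](t - 1)%R, t]))).
  rewrite normal_mean_itv; last by lra.
  apply: (@lt_le_trans _ _ (\int[mu]_(x in `](t - 1)%R, t]) m0)).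
    by rewrite Rintegral_cst // mu_itv; [rewrite opprB addrC subrK mulr1 | lra].
  apply: le_Rintegral => // x.
  rewrite /= in_itv /= => /andP[x1 x2]; rewrite phE ler_pM2l // ler_expR lerN2 ler_pM2r ?invr_gt0 //.
  rewrite -[x ^+ 2]real_normK ?num_real // lerXn2r ?nnegrE ?addr_ge0 //.
  have -> : x = t - (t - x) by ring.
  by rewrite (le_trans (ler_normB _ _)) // lerD2l ler_norml; apply/andP; split; lra.
apply: (mean_le Em); try by apply: bounded_measurable_indic; exact: measurable_itv.
move=> x; rewrite !indicE !mem_setE !in_itv /= ler_nat.
by case: (x <= t); rewrite ?andbF // andbT leq_b1.
Qed.

Let ph_bound x : ph x * (1 + x ^+ 2 / 2) <= c.
Proof.
rewrite phE -mulrA ger_pMr //.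
apply: (@le_trans _ _ (expR (- (x ^+ 2 / 2)) * expR (x ^+ 2 / 2))).
  by rewrite ler_pM2l ?expR_gt0 // expR_ge1Dx.
by rewrite -expRD addNr expR0.
Qed.

Let is_derive_ph (x : R) : is_derive x 1 ph (- (x * ph x)).
Proof.
have -> : ph = c *: (expR \o (- 2^-1 *: (id ^+ 2))).
  apply/funext => y; rewrite phE /= /GRing.scale /= !fctE /=; congr (_ * expR _).
  by rewrite /GRing.scale /= mulNr mulrC.
by apply: is_derive_eq; rewrite /GRing.scale /= !fctE /= /GRing.scale /=; field.
Qed.

Let is_derive_sin_ph (a b x : R) : is_derive x 1 (fun x => sin (a * x + b) * ph x)
  (a * cos (a * x + b) * ph x - x * sin (a * x + b) * ph x).
Proof.
have d1 : is_derive x 1 (sin \o (a *: id + cst b)) (a * cos (a * x + b)).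
  by apply: is_derive_eq; rewrite /GRing.scale /= !fctE /=; ring.
have d2 := is_derive_ph x.
have -> : (fun x => sin (a * x + b) * ph x) = (sin \o (a *: id + cst b)) * ph by [].
by apply: is_derive_eq; rewrite /GRing.scale /= !fctE /=; ring.
Qed.

Let bounded_sin a b : bounded_measurable (fun x : R => sin (a * x + b)).
Proof.
rewrite (_ : (fun x => _) = (fun x => cos (a * x + (b - pi / 2)))); last first.
  by apply/funext => x; rewrite addrA cosBpihalf.
exact: bounded_measurable_cos.
Qed.

(** The difference of the two integrands is the derivative of [- sin (a x + b) ph x]. Its integral
    over [[- (n+1), n+1]] is a boundary term that [ph_bound] makes [O(1/n)], and dominated
    convergence passes to the whole line. *)
Let integral_by_parts a b :
  \int[mu]_x (x * sin (a * x + b) * ph x) = a * normal_mean (fun x => cos (a * x + b)).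
Proof.
pose h x := a * cos (a * x + b) * ph x - x * sin (a * x + b) * ph x.
pose H x := sin (a * x + b) * ph x.
have bs := bounded_sin a b; have bc := bounded_measurable_cos a b.
have i1 : mu.-integrable [set: R] (EFin \o (fun x => a * (cos (a * x + b) * ph x))).
  have := integrableZl measurableT a (integrable_ph bc).
  by apply: eq_integrable => // x _; rewrite /= EFinM.
have i2 := integrable_id_ph bs.
have hE : h = fun x => a * (cos (a * x + b) * ph x) - x * sin (a * x + b) * ph x.
  by apply/funext => x; rewrite /h mulrA.
have ih : mu.-integrable [set: R] (EFin \o h).
  by rewrite hE; have := integrableB measurableT i1 i2.
suff h0 : \int[mu]_x h x = 0.
  move: h0; rewrite hE RintegralB // RintegralZl //; last exact: integrable_ph.
  by move/eqP; rewrite subr_eq0 => /eqP ->.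
have ch : continuous h.
  move=> x; have d1 := is_derive_sin_ph a b.
  have c1 : {for x, continuous ph} by apply: continuous_normal_pdf; exact: oner_neq0.
  have c2 : {for x, continuous (fun x => a * x + b)}.
    by apply: cvgD; [apply: cvgM; [exact: cvg_cst | exact: cvg_id] | exact: cvg_cst].
  have c3 : {for x, continuous (fun x => cos (a * x + b))}.
    by apply: continuous_comp; [exact: c2 | exact: continuous_cos].
  have c4 : {for x, continuous (fun x => sin (a * x + b))}.
    by apply: continuous_comp; [exact: c2 | exact: continuous_sin].
  apply: cvgB; first by apply: cvgM => //; apply: cvgM => //; exact: cvg_cst.
  by apply: cvgM => //; apply: cvgM => //; exact: cvg_id.
have FTC (n : nat) : (\int[mu]_(x in `[(- n.+1%:R)%R, n.+1%:R%R]) (h x)%:E =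
    (H n.+1%:R - H (- n.+1%:R)%R)%R%:E)%E.
  have n0 : 0 < n.+1%:R :> R by rewrite ltr0n.
  have dH x : derivable H x 1 by have [] := is_derive_sin_ph a b x.
  have cH : continuous H by move=> x; apply: differentiable_continuous; exact/derivable1_diffP.
  rewrite EFinB; apply: (continuous_FTC2 (F := H)).
  - by lra.
  - exact: continuous_subspaceT.
  - split; [by move=> x _ | exact/cvg_at_right_filter/cH | exact/cvg_at_left_filter/cH].
  - by move=> x _; rewrite derive1E; have [_ ->] := is_derive_sin_ph a b x.
pose hn (n : nat) x : \bar R := ((h \_ `[- n.+1%:R, n.+1%:R]) x)%:E.
have cv : (\int[mu]_x hn n x)%E @[n --> \oo] --> (\int[mu]_x (h x)%:E)%E.
  apply: (@dominated_cvg _ _ _ mu _ measurableT hn _ (fun x => `|(h x)%:E|)%E) => //.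
  - move=> n; apply/measurable_EFinP; apply/(measurable_restrictT _ _).1 => //.
    by apply: measurable_funTS; exact: continuous_measurable_fun.
  - move=> x _; apply: cvg_near_cst; exists (Num.bound `|x|) => // n /= nx.
    rewrite /hn patchE mem_set //= in_itv /= -ler_norml.
    by rewrite (le_trans (ltW (archi_boundP (normr_ge0 x)))) // ler_nat leqW.
  - exact: integrable_abse.
  - move=> n x _; rewrite /hn patchE; case: ifP => _ //.
    by rewrite abse0.
have cv0 : (\int[mu]_x hn n x)%E @[n --> \oo] --> 0%E.
  rewrite (_ : (fun n => _) = (fun n => (H n.+1%:R - H (- n.+1%:R))%:E)); last first.
    apply/funext => n; rewrite -FTC [RHS]integral_mkcond.
    by apply: eq_integral => x _; rewrite /hn restrict_EFin.
  apply: cvg_EFin; first exact: nearW.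
  have Hb (n : nat) : `|H n.+1%:R - H (- n.+1%:R)| <= 4 * c * n.+1%:R^-1.
    have n1 : 1 <= n.+1%:R :> R by rewrite ler1n.
    have pb x : `|x| = n.+1%:R -> `|H x| <= 2 * c * n.+1%:R^-1.
      move=> xn; rewrite /H normrM [`|ph x|]ger0_norm //.
      apply: (@le_trans _ _ (ph x)); first by rewrite ler_piMl // sin_max.
      rewrite ler_pdivlMr ?ltr0n //.
      have := ph_bound x; rewrite -[x ^+ 2]real_normK ?num_real // xn => pbx.
      have := ph_ge0 x; nra.
    apply: (le_trans (ler_normB _ _)).
    have := pb n.+1%:R (ger0_norm (ler0n _ _)).
    have := pb (- n.+1%:R); rewrite normrN (ger0_norm (ler0n _ _)) => /(_ erefl) p1 p2.
    have -> : 4 * c * n.+1%:R^-1 = 2 * c * n.+1%:R^-1 + 2 * c * n.+1%:R^-1 by ring.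
    exact: lerD.
  have ch0 : (4 * c * n.+1%:R^-1) @[n --> \oo] --> (0 : R).
    rewrite -[X in _ --> X](mulr0 (4 * c)); apply: cvgM; first exact: cvg_cst.
    exact: cvg_harmonic.
  apply: (@squeeze_cvgr _ _ _ _ (fun n : nat => - (4 * c * n.+1%:R^-1)) (fun n : nat => 4 * c * n.+1%:R^-1)) => //.
  - by apply: nearW => n /=; rewrite -ler_norml Hb.
  - by rewrite -oppr0; exact: cvgN.
by rewrite /Rintegral (cvg_unique _ cv cv0).
Qed.

(** As a function [F] of [a], the left side satisfies [F' = - a F], by differentiation under the
    integral with majorant [K * psi] and by parts. So [F a * exp (a^2 / 2)] is constant, with value
    [cos b] at 0. *)
Lemma normal_mean_cos a b :
  normal_mean (fun x => cos (a * x + b)) = cos b * expR (- (a ^+ 2 / 2)).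
Proof.
pose f a x := cos (a * x + b) * ph x.
pose F a := \int[mu]_x f a x.
have d1 (r x : R) : is_derive r 1 (f ^~ x) (- (x * sin (r * x + b)) * ph x).
  have d2 : is_derive r 1 (cos \o (x *: id + cst b)) (- (x * sin (x * r + b))).
    by apply: is_derive_eq; rewrite /GRing.scale /= !fctE /=; ring.
  have -> : f ^~ x = ph x *: (cos \o (x *: id + cst b)).
    by apply/funext => y; rewrite /f /GRing.scale /= !fctE /= mulrC [y * x]mulrC.
  by apply: is_derive_eq; rewrite /GRing.scale /= [r * x]mulrC [RHS]mulrC.
have d1E (r x : R) : partial1of2 f r x = - (x * sin (r * x + b)) * ph x.
  by rewrite /partial1of2 derive1E; have [_ ->] := d1 r x.
have intf r : mu.-integrable [set: R] (EFin \o f r).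
  exact/integrable_ph/bounded_measurable_cos.
have intG : mu.-integrable [set: R] (EFin \o (fun x => K * psi x)).
  exact: (integrableZl measurableT K ipsi).
have G0 x : 0 <= K * psi x by rewrite mulr_ge0 // normal_pdf_ge0.
have Gub (r x : R) : `|partial1of2 f r x| <= K * psi x.
  rewrite d1E normrM normrN normrM [`|ph x|]ger0_norm // mulrAC.
  by apply: le_trans (ph_psi x); rewrite ler_piMr ?mulr_ge0 // sin_max.
have dF (r : R) : is_derive r 1 F (- r * F r).
  have I r' : (`](r - 1)%R, (r + 1)%R[%classic : set R) r' -> True by [].
  have Ir : (`](r - 1)%R, (r + 1)%R[%classic : set R) r by rewrite /= in_itv /=; apply/andP; split; lra.
  have dF1 := @derivable_under_integral R _ _ mu f [set: R] measurableT r (r - 1) (r + 1) Ir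
    (fun x _ => intf x) (fun x y _ _ => @ex_derive _ _ _ _ _ _ _ (d1 x y)) _ G0 intG (fun x y _ _ => Gub x y).
  have dF2 := @differentiation_under_integral R _ _ mu f [set: R] measurableT r (r - 1) (r + 1) Ir
    (fun x _ => intf x) (fun x y _ _ => @ex_derive _ _ _ _ _ _ _ (d1 x y)) _ G0 intG (fun x y _ _ => Gub x y).
  apply: DeriveDef => //; rewrite -derive1E dF2.
  under eq_Rintegral do rewrite d1E.
  transitivity (\int[mu]_x (-1 * (x * sin (r * x + b) * ph x))).
    by apply: eq_Rintegral => x _; ring.
  rewrite RintegralZl //; last exact/integrable_id_ph/bounded_sin.
  by rewrite integral_by_parts /F /normal_mean /f; ring.
pose G r := F r * expR (r ^+ 2 / 2).
have dG (r : R) : is_derive r 1 G 0.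
  have -> : G = F * (expR \o (2^-1 *: (id ^+ 2))).
    by apply/funext => y; rewrite /G !fctE /= /GRing.scale /= [2^-1 * _]mulrC.
  have dFr := dF r.
  by apply: is_derive_eq; rewrite /GRing.scale /= !fctE /= /GRing.scale /=; field.
have := is_derive_0_is_cst a 0 dG; rewrite /G expr0n mul0r expR0 mulr1.
have -> : F 0 = cos b.
  rewrite /F /f; under eq_Rintegral do rewrite mul0r add0r.
  by rewrite RintegralZl // /Rintegral integral_normal_pdf mulr1.
move=> <-; rewrite -mulrA -expRD addrN expR0 mulr1.
by [].
Qed.

End standard_normal.

(** * Asymptotic normality *)

Section uniform_tableau.
Local Open Scope ring_scope.
Local Open Scope classical_set_scope.
Variables (R : realType) (la : intpart).
Let N : R := #|{: SYT la}|%:R.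
Local Notation P := (uniform_SYT R la).

Lemma card_SYT_gt0 : 0 < N.
Proof. by rewrite /N ltr0n; apply/card_gt0P; exists (row_tableau la). Qed.

Let uniform_set1 T : P [set T] = (N^-1)%:E.
Proof.
rewrite /uniform_SYT /= /mscale /= /counting asboolT; last exact: finite_set1.
by rewrite fset_set1 finmap.cardfs1 mule1.
Qed.

Lemma integral_uniform_SYT (f : SYT la -> R) :
  (\int[P]_T (f T)%:E = ((\sum_T f T) / N)%:E)%E.
Proof.
have mS (A : set (SYT la)) : measurable A by [].
have ii T : P.-integrable [set: SYT la] (fun x => (f T)%:E * (\1_[set T] x)%:E)%E.
  by apply: integrableZl => //; apply: integrable_indic => //; rewrite probability_setT.
rewrite (eq_integral (fun x => \sum_(T : SYT la) (f T)%:E * (\1_[set T] x)%:E)%E); last first.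
  move=> x _; rewrite (bigD1 x) //= indicE mem_set // mule1 big1 ?adde0 // => T Tx.
  by rewrite indicE memNset ?mule0 // => xT; rewrite xT eqxx in Tx.
rewrite integral_sum // mulr_suml -sumEFin; apply: eq_bigr => T _.
rewrite integralZl //; last by apply: integrable_indic => //; rewrite probability_setT.
by rewrite integral_indic // setIT [X in (_ * X)%E](uniform_set1 T).
Qed.

Lemma uniform_SYTE (A : set (SYT la)) : P A = ((\sum_T \1_A T) / N)%:E.
Proof. by rewrite -integral_uniform_SYT integral_indic // setIT. Qed.

Let sigma : R := Num.sqrt (sqdefect R la / 12).

Lemma standardize_maj T : standardize (maj_RV R la) T =
  if sigma == 0 then 0 else ((maj T)%:R - maj_center R la) / sigma.
Proof.
have N0 := card_SYT_gt0.
have mean : fine 'E_P[maj_RV R la] = maj_center R la.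
  rewrite unlock integral_uniform_SYT /=.
  have := sum_maj R la; rewrite sumrB sumr_const => /eqP; rewrite subr_eq0 => /eqP ->.
  by rewrite -mulr_natr mulfK // gt_eqF.
have var : fine 'V_P[maj_RV R la] = sqdefect R la / 12.
  rewrite /variance unlock mean unlock.
  rewrite (eq_integral (fun T => (((maj T)%:R - maj_center R la) ^+ 2)%:E)); last first.
    by move=> x _; rewrite expr2.
  by rewrite integral_uniform_SYT /= sum_sq_maj mulrC mulKf // gt_eqF.
by rewrite /standardize mean var.
Qed.

Definition std_mean (f : R -> R) : R :=
  (\sum_T f (standardize (maj_RV R la) T)) / N.

Lemma std_mean_is_mean : is_mean std_mean.
Proof.
have N0 := card_SYT_gt0; split=> [f g _ _|a f _|f g _ _ fg|].
- by rewrite /std_mean big_split mulrDl.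
- by rewrite /std_mean -mulr_sumr mulrA.
- by rewrite /std_mean ler_pM2r ?invr_gt0 // ler_sum.
- by rewrite /std_mean sumr_const divff // gt_eqF.
Qed.

Lemma uniform_standardize t :
  P [set T | standardize (maj_RV R la) T <= t] = (std_mean \1_(`]-oo, t]))%:E.
Proof.
rewrite uniform_SYTE; congr (_ / _)%:E; apply: eq_bigr => T _.
Qed.

Let sigma2_ge0 : 0 <= sqdefect R la / 12.
Proof. by rewrite divr_ge0 // sqdefect_ge0. Qed.

(* If [i] is a descent then [i + 1] is not in the first row, and otherwise it is not in the first column. *)
Lemma maj_range : exists lo : R, forall T : SYT la,
  lo <= (maj T)%:R <= lo + (aft la * sumn la)%:R.
Proof.
have [sh|hs] := leqP (size la) (head 0%N la).
  exists 0 => T; rewrite ler0n add0r ler_nat mulnC aftE head_conj_parts.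
  by rewrite (maxn_idPl sh) maj_le.
exists ((\sum_(0 <= i < sumn la) i)%N%:R - (aft la * sumn la)%:R) => T.
rewrite subrK lerBlDr -natrD !ler_nat aftE head_conj_parts (maxn_idPr (ltnW hs)).
rewrite mulnC maj_ge /= /maj; case: (posnP (sumn la)) => [->|n0]; first by rewrite big_geq.
rewrite big_mkcond [X in (_ <= X)%N]big_ltn // add0n.
by apply: leq_sum => i _; case: ifP.
Qed.

(** The center is the mean, so it lies in the same interval as the values. *)
Lemma maj_center_dist (T : SYT la) : `|(maj T)%:R - maj_center R la| <= (aft la * sumn la)%:R.
Proof.
have [lo lohi] := maj_range; have N0 := card_SYT_gt0.
have NE : N * maj_center R la = \sum_(T : SYT la) (maj T)%:R.
  have := sum_maj R la; rewrite sumrB sumr_const => /eqP; rewrite subr_eq0 => /eqP ->.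
  by rewrite mulr_natl.
have cst (x : R) : N * x = \sum_(T : SYT la) x by rewrite sumr_const mulr_natl.
have c1 : lo <= maj_center R la.
  by rewrite -(ler_pM2l N0) NE cst ler_sum // => S _; case/andP: (lohi S).
have c2 : maj_center R la <= lo + (aft la * sumn la)%:R.
  by rewrite -(ler_pM2l N0) NE cst ler_sum // => S _; case/andP: (lohi S).
by have /andP[t1 t2] := lohi T; rewrite ler_norml; apply/andP; split; lra.
Qed.

(** The deviation is at most [aft * n], while [sigma^2 = S / 12 >= aft * n^2 / 576], as 576 = 12 *
    48. *)
Lemma standardize_sq_le (T : SYT la) : standardize (maj_RV R la) T ^+ 2 <= 576 * (aft la)%:R.
Proof.
rewrite standardize_maj; case: eqP => [_|/eqP s0].
  by rewrite expr0n -natrM ler0n.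
have s2 : 0 < sqdefect R la / 12.
  by rewrite -sqrtr_gt0 lt0r -/sigma s0 sqrtr_ge0.
rewrite expr_div_n /sigma sqr_sqrtr // ler_pdivrMr //.
have := hook_defect_sq_ge R la; rewrite -/(sqdefect R la) ler_pdivrMr ?ltr0n // => Sn.
have : ((maj T)%:R - maj_center R la) ^+ 2 <= (aft la * sumn la)%:R ^+ 2.
  by rewrite -real_normK ?num_real // lerXn2r ?nnegrE // maj_center_dist.
move/le_trans; apply; rewrite natrM exprMn expr2 -mulrA.
apply: (@le_trans _ _ ((aft la)%:R * (sqdefect R la * 48))).
  by apply: ler_wpM2l; rewrite ?ler0n.
by lra.
Qed.

(** Chebyshev's inequality; the bound is the same for all partitions, which gives tightness. *)
Lemma std_mean_tail M : 0 < M -> std_mean \1_[set x | M < `|x|] <= (M ^+ 2)^-1.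
Proof.
move=> M0; have N0 := card_SYT_gt0; have M2 : 0 < M ^+ 2 by rewrite exprn_gt0.
have sq : \sum_(T : SYT la) standardize (maj_RV R la) T ^+ 2 <= N.
  under eq_bigr do rewrite standardize_maj.
  case: eqP => [_|/eqP s0].
    by rewrite big1 ?ler0n // => T _; rewrite expr0n.
  have s2 : 0 < sqdefect R la / 12.
    by rewrite -sqrtr_gt0 lt0r -/sigma s0 sqrtr_ge0.
  rewrite (eq_bigr (fun T => ((maj T)%:R - maj_center R la) ^+ 2 / (sqdefect R la / 12))); last first.
    by move=> T _; rewrite expr_div_n /sigma sqr_sqrtr.
  by rewrite -mulr_suml sum_sq_maj mulfK // gt_eqF.
rewrite /std_mean ler_pdivrMr //.
apply: (@le_trans _ _ (\sum_(T : SYT la) (M ^+ 2)^-1 * standardize (maj_RV R la) T ^+ 2)).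
  apply: ler_sum => T _; rewrite indicE; case: (boolP (_ \in _)) => [|_].
    rewrite inE /= => Mx; rewrite mulrC ler_pdivlMr // mul1r -[leRHS]real_normK ?num_real //.
    by rewrite lerXn2r ?nnegrE // ltW.
  by rewrite mulr_ge0 ?sqr_ge0 // invr_ge0 ltW.
by rewrite -mulr_sumr ler_wpM2l // invr_ge0 ltW.
Qed.

(** Here [r] bounds [n^2 / sigma^2]. The first condition on [r] makes [t n <= 2] for
    [t = |a| / sigma]; the second makes the error [e] in the exponent at most 1/2, so that
    [|exp e - 1| <= 2 |e|]. *)
Lemma std_mean_cos a b : (0 < aft la)%N -> let r := 576 / (aft la)%:R in
  a ^+ 2 * r <= 4 -> 3 / 4 * a ^+ 4 * r <= 1 / 2 ->
  `|std_mean (fun x => cos (a * x + b)) - cos b * expR (- (a ^+ 2 / 2))| <= 3 / 2 * a ^+ 4 * r.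
Proof.
move=> aft0 r ar1 ar2; have N0 := card_SYT_gt0.
have aftR : 0 < (aft la)%:R :> R by rewrite ltr0n.
have [->|a0] := eqVneq a 0.
  rewrite /std_mean; under eq_bigr do rewrite mul0r add0r.
  rewrite sumr_const -[_ *+ _]mulr_natr mulfK ?gt_eqF // !expr0n /= mul0r oppr0 expR0 mulr1.
  by rewrite subrr normr0 mulr0 mul0r.
have n0 : (0 < sumn la)%N.
  by apply: leq_trans aft0 _; rewrite aftE leq_subr.
have nR : 0 < (sumn la)%:R :> R by rewrite ltr0n.
have Sn := hook_defect_sq_ge R la; rewrite -/(sqdefect R la) in Sn.
set S := sqdefect R la in Sn *; set n := (sumn la)%:R in nR Sn *.
have S0 : 0 < S.
  by apply: lt_le_trans Sn; rewrite divr_gt0 // mulr_gt0 // exprn_gt0.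
have s20 : 0 < S / 12 by rewrite divr_gt0.
have s0 : 0 < sigma by rewrite sqrtr_gt0.
have s2 : sigma ^+ 2 = S / 12 by rewrite sqr_sqrtr // ltW.
have nSr : n ^+ 2 / sigma ^+ 2 <= r.
  rewrite s2 /r ler_pdivrMr // mulrAC ler_pdivlMr //.
  by move: Sn; rewrite ler_pdivrMr ?ltr0n // mulrC; lra.
pose t := `|a| / sigma; have a0' : 0 < `|a| by rewrite normr_gt0.
have t0 : 0 < t by rewrite divr_gt0.
have t2 : t ^+ 2 = a ^+ 2 / sigma ^+ 2 by rewrite expr_div_n real_normK ?num_real.
have tn0 : 0 <= t * n by apply: mulr_ge0; exact: ltW.
have tn : t * n <= 2.
  rewrite -(@ler_pXn2r _ 2) // ?nnegrE //.
  rewrite exprMn t2; apply: (@le_trans _ _ (a ^+ 2 * r)).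
    by rewrite -mulrA ler_wpM2l ?sqr_ge0 // mulrC.
  by rewrite (le_trans ar1) // -natrX ler_nat.
have [e eb E] := sum_cos_maj t0 tn; have Esin := sum_sin_maj t0 tn.
have vE : - (t ^+ 2 * S / 24) = - (a ^+ 2 / 2).
  by rewrite t2 s2; field; rewrite gt_eqF.
rewrite -/S in E eb; rewrite vE in E.
have eb' : `|e| <= 3 / 4 * a ^+ 4 * r.
  apply: (le_trans eb); rewrite -/n.
  have -> : (t / 2) ^+ 4 * n ^+ 2 * S = 3 / 4 * a ^+ 4 * (n ^+ 2 / sigma ^+ 2).
    have -> : (t / 2) ^+ 4 = (t ^+ 2) ^+ 2 / 16 by field.
    by rewrite t2 s2; field; rewrite gt_eqF.
  by rewrite ler_wpM2l // mulr_ge0 // (exprM _ 2 2) sqr_ge0.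
have cosE x : cos (a * (x / sigma) + b) = cos b * cos (t * x) - Num.sg a * sin b * sin (t * x).
  have -> : a * (x / sigma) = Num.sg a * (t * x) by rewrite {1}[a]numEsg /t; ring.
  by rewrite cosD cos_sg // sin_sg; ring.
have -> : std_mean (fun x => cos (a * x + b)) = cos b * expR (- (a ^+ 2 / 2) + e).
  rewrite /std_mean (eq_bigr (fun T => cos b * cos (t * ((maj T)%:R - maj_center R la)) -
    Num.sg a * sin b * sin (t * ((maj T)%:R - maj_center R la)))); last first.
    by move=> T _; rewrite standardize_maj (gt_eqF s0) cosE.
  by rewrite sumrB -!mulr_sumr E Esin mulr0 subr0 -/N mulrCA [LHS]mulrC mulKf ?gt_eqF.
rewrite expRD -[X in _ - X]mulr1 mulrA -mulrBr normrM.
have e12 : `|e| <= 1 / 2 by apply: le_trans eb' ar2.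
have b1 : `|cos b * expR (- (a ^+ 2 / 2))| <= 1.
  rewrite normrM [`|expR _|]ger0_norm ?expR_ge0 //.
  by rewrite mulr_ile1 ?expR_ge0 ?cos_max // -expR0 ler_expR oppr_le0 divr_ge0 ?sqr_ge0.
apply: (@le_trans _ _ `|expR e - 1|); first by rewrite ler_piMl.
have := expR_bound e12; have : `|expR e - 1| <= `|expR e - 1 - e| + `|e|.
  by rewrite -{1}[expR e - 1](subrK e) ler_normD.
have e2 : 2 * e ^+ 2 <= `|e|.
  rewrite -real_normK ?num_real // expr2 mulrA ler_piMl //; lra.
lra.
Qed.

End uniform_tableau.

Local Open Scope classical_set_scope.

Theorem theorem1p3 (R : realType) (la : nat -> intpart) :
  asymptotically_normal (fun N => maj_RV R (la N)) <->
  aft (la N) @[N --> \oo] --> \oo.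
Proof.
have cdfE t : normal_prob 0%R 1%R `]-oo, t] = (normal_mean (\1_(`]-oo, t]) : R -> R))%:E.
  by rewrite normal_probE //; exact: measurable_itv.
have stdE t : (fun n => uniform_SYT R (la n) [set T | standardize (maj_RV R (la n)) T <= t]%R) =
    (fun n => (@std_mean R (la n) \1_(`]-oo, t]))%:E).
  by apply/funext => n; exact: uniform_standardize.
split=> [normal|aft_oo t].
- apply/cvgnyPge => A.
  (* If [aft < A], then [X^2 <= 576 A < (24 A + 1)^2], so [X] never reaches [t]; but the normal
     distribution gives []-oo, t]] positive mass. *)
  pose t : R := (- (24 * A%:R + 1))%R.
  have := normal t; rewrite cdfE stdE.
  move=> /fine_cvgP[_] /=.
  move=> /cvgr_gt/(_ _ (normal_mean_gt0 t)).
  apply: filterS => n; apply: contraPT; rewrite -ltnNge => aA.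
  apply/negP; rewrite -leNgt /= /std_mean big1 ?mul0r // => T _.
  rewrite indicE memNset //= in_itv /= => Xt.
  have := @standardize_sq_le R (la n) T.
  have : ((aft (la n))%:R <= A%:R :> R)%R by rewrite ler_nat ltnW.
  have A0 := ler0n R A.
  set X := standardize _ _ in Xt *; rewrite /t in Xt.
  have : ((24 * A%:R + 1) ^+ 2 <= X ^+ 2)%R.
    by rewrite -[(X ^+ 2)%R]sqrrN lerXn2r ?nnegrE; lra.
  have : (A%:R <= A%:R ^+ 2 :> R)%R by rewrite -natrX ler_nat; case: (A) => // m; rewrite leq_pmulr.
  by rewrite sqrrD; lra.
rewrite cdfE stdE.
apply: cvg_EFin; first exact: nearW.
apply: (cvg_mean_step (Es := fun n => @std_mean R (la n))).
- by move=> n; exact: std_mean_is_mean.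
- exact: normal_mean_is_mean.
- move=> a b; rewrite normal_mean_cos; apply/cvgrPdist_le => e e0.
  have a20 : (0 <= a ^+ 2)%R by rewrite sqr_ge0.
  have a40 : (0 <= a ^+ 4)%R by rewrite (exprM _ 2 2) sqr_ge0.
  (* One summand for each condition: the two hypotheses of [std_mean_cos], and its bound being at
     most [e]. *)
  pose c : R := (576 * (a ^+ 2 + 2 * a ^+ 4 + 2 * a ^+ 4 / e))%R.
  have c0 : (0 <= 2 * a ^+ 4 / e)%R by apply: divr_ge0; [exact: mulr_ge0 | exact: ltW].
  have : \forall n \near \oo, (Num.bound c < aft (la n))%N.
    by move/cvgnyPge : aft_oo => /(_ (Num.bound c).+1).
  apply: filterS => n cn; rewrite distrC.
  have aft0 : (0 < aft (la n))%N by apply: leq_ltn_trans cn.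
  have aftR : (0 < (aft (la n))%:R :> R)%R by rewrite ltr0n.
  have c1 : (0 <= c)%R by rewrite /c; lra.
  have ca : (c <= (aft (la n))%:R)%R.
    by rewrite (le_trans (ltW (archi_boundP c1))) // ler_nat ltnW.
  have rle (x y : R) : (0 < y)%R -> (576 * (x / y) <= c -> x * (576 / (aft (la n))%:R) <= y)%R.
    move=> y0 xc; rewrite mulrA ler_pdivrMr //.
    have : (576 * (x / y) <= (aft (la n))%:R)%R by apply: le_trans ca.
    by rewrite mulrA ler_pdivrMr // mulrC [(y * _)%R]mulrC.
  apply: (le_trans (@std_mean_cos R (la n) a b aft0 _ _)).
  + by apply: rle => //; rewrite /c; lra.
  + by apply: rle => //; rewrite /c; lra.
  + by apply: rle => //; rewrite /c; lra.
- move=> e e0; have [M M0 nM] := @normal_mean_tail R e e0.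
  (* Exceeds [M] for the normal tail, and satisfies [M'^2 >= M' >= 1 / e] for the tableaux. *)
  pose M' : R := (M + e^-1 + 1)%R; have ei : (0 < e^-1)%R by rewrite invr_gt0.
  have M'0 : (0 < M')%R by rewrite /M'; lra.
  exists M'; first exact: ltW.
  split=> [|n].
    apply: le_trans nM; apply: (mean_le (normal_mean_is_mean R)); try exact: bounded_tail.
    move=> x; rewrite !indicE ler_nat; case: (boolP (x \in _)) => // xM.
    by rewrite mem_set //=; move: xM; rewrite inE /= /M'; lra.
  apply: (le_trans (std_mean_tail _ M'0)).
  rewrite -[leRHS]invrK lef_pV2 ?posrE ?exprn_gt0 //.
  apply: (@le_trans _ _ M'); first by rewrite /M'; lra.
  by rewrite expr2 ler_pMl // /M'; lra.
move=> e e0; pose c : R := normal_peak 1.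
have c0 : (0 < c)%R by exact: normal_peak_gt0 (oner_neq0 _).
exists (e / (2 * c))%R; first by rewrite divr_gt0 // mulr_gt0.
apply: (le_trans (normal_mean_cont _ _)); first by rewrite divr_gt0 // mulr_gt0.
by rewrite -/c (_ : (c * _)%R = e) //; field; rewrite gt_eqF.
Qed.
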